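(* Let $\tilde v_0\in\mathcal{P}_1$ and $$\tau_{\mathcal N}(\tilde v_0)=\frac1{\mu_1-\mu_0}\log\left(\frac{\|\tilde v_0-c_0(\tilde v_0)e_0\|_{L^2}\,\|1-c_0(1)e_0\|_{L^2}}{c_0(\tilde v_0)\int_0^1e_0(\xi)d\xi}\right)$$ (equal to $-\infty$ if the argument of the logarithm is $0$). Then for every $t\ge0$ with $t>\tau_{\mathcal N}(\tilde v_0)$ and every $x\in[0,1]$, $\tilde v(t,\cdot)=\Phi^t_{\mathcal N}(\tilde v_0)$ has the convergent Koopman decomposition (summed in the indicated order) $$\tilde v(t,x)=\sum_{q_0=0}^\infty\ \sum_{m=0}^\infty\ \sum_{(q_1,\dots,q_m)\in(\mathbb{N}\setminus\{0\})^m}e^{-\lambda_\nu t}\,\psi_\nu(\tilde v_0)\,b_\nu(x),\qquad\nu=(q_0,\dots,q_m),$$ where $$\lambda_\nu=\sum_{i=0}^m(\mu_{q_i}-\mu_0),\qquad\psi_\nu=\prod_{i=0}^m\frac{c_{q_i}}{c_0},\qquad b_\nu(x)=(-1)^m\frac{\prod_{i=1}^mp_{q_i}}{\int_0^1e_0(\xi)d\xi}\,e_{q_0}(x),\qquad p_q=\frac{\int_0^1e_q(\xi)d\xi}{\int_0^1e_0(\xi)d\xi}.$$ In particular, the decomposition is valid for all $t\ge0$ if $\tilde v_0$ belongs to the neighbourhood of $\tilde f_0=e_0/\int_0^1e_0(\xi)d\xi$ in $\mathcal{P}_1$ given by $$\Omega_{\mathcal N}=\left\{\tilde v_0\in\mathcal{P}_1:\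 \frac{\|\tilde v_0-c_0(\tilde v_0)e_0\|_{L^2}\,\|1-c_0(1)e_0\|_{L^2}}{c_0(\tilde v_0)\int_0^1e_0(\xi)d\xi}<1\right\}.$$
   Context: $V:[0,1]\to\mathbb{R}$ is a fixed smooth, strictly positive function; $\mathbb{N}=\{0,1,2,\dots\}$. $\mathcal{P}_1$ is the set of strictly positive functions $v$ on $[0,1]$, square integrable together with their first weak derivative, with $\int_0^1v(s)ds=1$; it carries the $H^1$ norm $\|v\|_{H^1}^2=\|v\|_{L^2}^2+\|\partial_xv\|_{L^2}^2$. $\Phi^t_{\mathcal N}$ ($t\ge0$) is the flow on $\mathcal{P}_1$ of the nonlinear heat equation, i.e. $\Phi^t_{\mathcal N}(\tilde v_0)=\tilde v(t,\cdot)$ where $$\partial_t\tilde v=\partial_{xx}^2\tilde v-V\tilde v+\Big(\int_0^1V(\xi)\tilde v(t,\xi)d\xi\Big)\tilde v,\qquad \partial_x\tilde v(t,0)=\partial_x\tilde v(t,1)=0,\qquad \tilde v(0,\cdot)=\tilde v_0.$$ The operator $A=-\partial^2_{xx}+V$ on $[0,1]$ with Neumann boundary conditions is self-adjoint, with eigenvalues $0<\mu_0<\mu_1\le\mu_2\le\dots$ and a complete orthonormal family $(e_n)_{n\in\mathbb{N}}$ in $L^2([0,1])$ of real eigenfunctions: $-\partial_{xx}^2e_n+Ve_n=\mu_ne_n$, $\partial_xe_n(0)=\partial_xe_n(1)=0$, with $e_0>0$ on $[0,1]$. Put $c_n(v)=\int_0^1e_n(x)v(x)\,dx$ (in particular $c_0(1)=\int_0^1e_0$).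 For $m=0$ the inner sum has a single term and empty products equal $1$. *)

(* Defs.v *)
From mathcomp Require Import all_boot all_order all_algebra.
From mathcomp Require Import all_classical all_reals all_analysis.
From mathcomp Require showcase.summability.

Set Implicit Arguments.
Unset Strict Implicit.
Unset Printing Implicit Defensive.

Import Order.TTheory GRing.Theory Num.Theory.
Import numFieldNormedType.Exports.

Local Open Scope classical_set_scope.
Local Open Scope ring_scope.

(* Functions on [0,1] are total functions R -> R of which only the values on
   `[0, 1] are ever used. *)
Definition unitI (R : realType) : set R := `[0, 1]%classic.
Arguments unitI {R}.

Definition int01 (R : realType) (f : R -> R) : R :=
  \int[@lebesgue_measure R]_(x in unitI) f x.

(* [f'] is the derivative of [f] relative to [D]; it is one-sided at the
   endpoints when [D] is a closed interval. *)
Definition deriv_on (R : realType) (D : set R) (f f' : R -> R) : Prop :=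
  forall x, D x ->
    (fun y => (f y - f x) / (y - x)) @ within D (dnbhs x) --> f' x.

Definition smooth01 (R : realType) (f : R -> R) : Prop :=
  exists df : nat -> R -> R,
    df 0%N = f /\ forall k, deriv_on unitI (df k) (df k.+1).

Definition L2 (R : realType) : set (R -> R) := [set f : R -> R |
  measurable_fun unitI f /\
  (@lebesgue_measure R).-integrable unitI (fun x => (f x ^+ 2)%:E)].

Definition L2norm (R : realType) (f : R -> R) : R :=
  Num.sqrt (int01 (fun x => f x ^+ 2)).

(* Test functions C^1_c(]0,1[) *)
Definition test_function (R : realType) (phi : R -> R) : Prop :=
  [/\ forall x, derivable phi x 1,
      continuous (derive1 phi) &
      exists a b : R, [/\ 0 < a, b < 1 &
        forall x, ~ (a <= x <= b) -> phi x = 0]].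

Definition weak_derivative (R : realType) (f : R -> R) : set (R -> R) :=
  [set g : R -> R | L2 g /\ forall phi, test_function phi ->
     int01 (fun x => f x * derive1 phi x) = - int01 (fun x => g x * phi x)].

(* Elements of H^1 are represented by their continuous representative, so that
   pointwise values make sense. *)
Definition H1 (R : realType) : set (R -> R) := [set f : R -> R |
  [/\ {within unitI, continuous f}, L2 f & exists g, weak_derivative f g]].

(* The weak derivative is unique almost everywhere, so the norm does not depend
   on the one selected here; meaningful for [f] in [H1] only. *)
Definition H1norm (R : realType) (f : R -> R) : R :=
  Num.sqrt (L2norm f ^+ 2
            + L2norm (xget (cst 0 : R -> R) (weak_derivative f)) ^+ 2).

Definition P1 (R : realType) : set (R -> R) := [set v : R -> R |
  [/\ H1 v, forall x, unitI x -> 0 < v x & int01 v = 1]].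

Definition nbhs_in_P1 (R : realType) (f : R -> R) (U : set (R -> R)) : Prop :=
  [/\ P1 f, U `<=` @P1 R & exists2 eps : R, 0 < eps &
     forall g, P1 g -> H1norm (g \- f) < eps -> U g].

(* Solutions are continuous in time with values in P1 (with the H^1 norm) up to
   t = 0, and of class C^{1,2}(]0,+oo[ x [0,1]). *)
Record nonlinear_heat_solution (R : realType) (V v0 : R -> R)
    (v : R -> R -> R) : Prop := {
  heat_init : forall x, unitI x -> v 0 x = v0 x;
  heat_P1 : forall t : R, 0 <= t -> P1 (v t);
  heat_continuous : forall s : R, 0 <= s ->
    (fun t : R => H1norm (v t \- v s)) @ within `[0, +oo[ (nbhs s) --> 0;
  heat_equation : exists vt vx vxx : R -> R -> R,
    (forall w : R -> R -> R, [\/ w = v, w = vt, w = vx | w = vxx] ->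
       {within `]0, +oo[ `*` unitI, continuous (fun p : R * R => w p.1 p.2)})
    /\ forall t : R, 0 < t ->
    [/\ forall x, unitI x -> is_derive t (1 : R) (fun s : R => v s x) (vt t x),
        deriv_on unitI (v t) (vx t),
        deriv_on unitI (vx t) (vxx t),
        vx t 0 = 0 /\ vx t 1 = 0 &
        forall x, unitI x ->
          vt t x = vxx t x - V x * v t x
                   + int01 (fun xi => V xi * v t xi) * v t x] }.

Definition nonlinear_heat_flow (R : realType) (V : R -> R)
    (Phi : R -> (R -> R) -> R -> R) : Prop :=
  forall v0, P1 v0 -> nonlinear_heat_solution V v0 (fun t => Phi t v0).

Definition neumann_eigenfunction (R : realType) (V : R -> R) (m : R)
    (f : R -> R) : Prop :=
  exists f' f'' : R -> R,
    [/\ deriv_on unitI f f', deriv_on unitI f' f'',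
        f' 0 = 0 /\ f' 1 = 0 &
        forall x, unitI x -> - f'' x + V x * f x = m * f x].

Section Koopman.
Variables (R : realType) (mu : nat -> R) (e : nat -> R -> R).

Definition coef (n : nat) (v : R -> R) : R := int01 (fun x => e n x * v x).

Record neumann_eigenbasis (V : R -> R) : Prop := {
  eigen_gt0 : 0 < mu 0%N;
  eigen_gap : mu 0%N < mu 1%N;
  eigen_mono : forall n, (0 < n)%N -> mu n <= mu n.+1;
  eigen_fun : forall n, neumann_eigenfunction V (mu n) (e n);
  eigen_pos : forall x, unitI x -> 0 < e 0%N x;
  eigen_orthonormal : forall m n,
    int01 (fun x => e m x * e n x) = (m == n)%:R;
  eigen_complete : forall f, L2 f ->
    (fun N => L2norm (fun x => f x - \sum_(n < N) coef n f * e n x))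
      @ \oo --> 0 }.

Definition pcoef (q : nat) : R := int01 (e q) / int01 (e 0%N).

Definition lambda_ (nu : seq nat) : R := \sum_(q <- nu) (mu q - mu 0%N).

Definition psi_ (nu : seq nat) (v : R -> R) : R :=
  \prod_(q <- nu) (coef q v / coef 0%N v).

Definition b_ (nu : seq nat) (x : R) : R :=
  (-1) ^+ size (behead nu)
  * ((\prod_(q <- behead nu) pcoef q) / int01 (e 0%N)) * e (head 0%N nu) x.

Definition koopman_term (v0 : R -> R) (t x : R) (nu : seq nat) : R :=
  expR (- lambda_ nu * t) * psi_ nu v0 * b_ nu x.

(* The innermost sum, over a countable set of multi-indices without a given
   order, is the unconditional one (limit along the directed set of finite
   subsets); the two outer ones are ordinary series. *)
Definition koopman_decomposition (v0 : R -> R) (t x y : R) : Prop :=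
  exists (s2 : nat -> nat -> R) (s1 : nat -> R),
  [/\ forall q0 m,
        summability.partial_sum (fun qs : m.-tuple {q : nat | (0 < q)%N} =>
          koopman_term v0 t x (q0 :: [seq val q | q <- qs]))
        @ summability.totally --> s2 q0 m,
      forall q0, series (s2 q0) @ \oo --> s1 q0 &
      series s1 @ \oo --> y].

Definition koopman_ratio (v0 : R -> R) : R :=
  L2norm (fun x => v0 x - coef 0%N v0 * e 0%N x)
  * L2norm (fun x => 1 - coef 0%N (cst 1) * e 0%N x)
  / (coef 0%N v0 * int01 (e 0%N)).

Definition tau_ (v0 : R -> R) : \bar R :=
  if koopman_ratio v0 == 0 then -oo%E
  else ((mu 1%N - mu 0%N)^-1 * ln (koopman_ratio v0))%:E.

Definition f0_ : R -> R := fun x => e 0%N x / int01 (e 0%N).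

Definition Omega_ : set (R -> R) :=
  [set v0 | P1 v0 /\ koopman_ratio v0 < 1].

End Koopman.

(* Main.v *)
(** Testing the equation against [e n] shows that the nonlinear term only rescales
    the solution: [c_n / c_0] decays exactly like [exp (- (mu_n - mu_0) t)].  The
    missing factor [c_0] is recovered from the conservation of mass: Parseval's
    identity for the pair [v t], [1] reads
      [c_0 (v t) * int e_0 * (1 + \sum_(n >= 1) a_n p_n) = 1]
    with [a_n] the decayed ratio.  By Cauchy-Schwarz the sum has modulus [< 1] for
    [t > tau], and the [m]-th term of the resulting geometric series is the sum over
    [m]-tuples.  The outer sum is then the eigenfunction expansion of [v t], which
    has to converge at every point, including at [t = 0] where [v 0] is only in H^1. *)
Require Import Defs.
From mathcomp Require Import all_boot all_order all_algebra.
From mathcomp Require Import all_classical all_reals all_analysis.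
From mathcomp Require Import measurable_realfun finmap ring lra.
From mathcomp Require showcase.summability.

Import Order.TTheory GRing.Theory Num.Theory.
Import numFieldNormedType.Exports.

Local Open Scope classical_set_scope.
Local Open Scope ring_scope.

Set Implicit Arguments.
Unset Strict Implicit.
Unset Printing Implicit Defensive.

(** * Integration and L2 on the unit interval *)

(** Limited regularity shapes two steps. The weak derivative of an H^1 function is tested only
    against functions with compact support in ]0,1[, whereas the functions to pair with it are the
    derivatives of the [e n], which vanish at the endpoints but not near them. Integration by parts
    is therefore extended to C^1 functions that merely vanish at both endpoints. With the Neumann
    conditions this makes the [e n] orthogonal for the energy form as well, so that Bessel's
    identity has an energy version, and the differentiated partial sums are bounded in L2 uniformly
    in their length. In time, the equation is available for t > 0 only: the ratios are
    differentiated on an open interval and carried down to t = 0 by continuity in the H^1 norm. *)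

Lemma quadratic_ge0_discriminant (R : realFieldType) (a b c : R) : 0 <= c ->
  (forall z, 0 <= a + 2 * z * b + z ^+ 2 * c) -> b ^+ 2 <= a * c.
Proof.
rewrite le_eqVlt => /predU1P[c0|c0] pos; last first.
(* The quadratic attains its minimum at [- b / c]. *)
- have := mulr_ge0 (ltW c0) (pos (- b / c)).
  have -> : c * (a + 2 * (- b / c) * b + (- b / c) ^+ 2 * c) = a * c - b ^+ 2.
    by field; rewrite gt_eqF.
  by rewrite subr_ge0.
- rewrite -c0 mulr0; have [->|b0] := eqVneq b 0; first by rewrite expr0n.
  (* For [c = 0] and [b != 0] the expression is affine in [z], and takes the value -1 at this
     point. *)
  have := pos (- (a + 1) / (2 * b)); rewrite -c0 mulr0 addr0.
  have -> : 2 * (- (a + 1) / (2 * b)) * b = - (a + 1) by field.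
  lra.
Qed.

Section Integrals.
Variable R : realType.
Implicit Types (f g : R -> R) (x y c : R).
Local Notation mu := (@lebesgue_measure R).

Definition integrable01 f := mu.-integrable unitI (EFin \o f).
Definition continuous01 f := {within unitI, continuous f}.

Lemma measurable_unitI : measurable (unitI : set (measurableTypeR R)).
Proof. exact: measurable_itv. Qed.
Hint Resolve measurable_unitI : core.

Lemma compact_unitI : compact (unitI : set R).
Proof. exact: segment_compact. Qed.

Lemma unitIP x : unitI x <-> 0 <= x <= 1.
Proof. by rewrite /unitI /= in_itv. Qed.

Lemma unitI0 : unitI (0 : R).
Proof. by apply/unitIP; rewrite lexx ler01. Qed.

Lemma unitI1 : unitI (1 : R).
Proof. by apply/unitIP; rewrite lexx ler01. Qed.

Lemma continuous01P f :
  continuous01 f <-> forall x, unitI x -> f @ within unitI (nbhs x) --> f x.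
Proof. exact: subspace_continuousP. Qed.

Lemma continuous01_cst c : continuous01 (fun=> c).
Proof. by move=> x; exact: cvg_cst. Qed.

Lemma continuous01D f g :
  continuous01 f -> continuous01 g -> continuous01 (fun x => f x + g x).
Proof. by move=> cf cg x; apply: cvgD; [exact: cf|exact: cg]. Qed.

Lemma continuous01N f : continuous01 f -> continuous01 (fun x => - f x).
Proof. by move=> cf x; apply: cvgN; exact: cf. Qed.

Lemma continuous01B f g :
  continuous01 f -> continuous01 g -> continuous01 (fun x => f x - g x).
Proof. by move=> cf /continuous01N; exact: continuous01D. Qed.

Lemma continuous01M f g :
  continuous01 f -> continuous01 g -> continuous01 (fun x => f x * g x).
Proof. by move=> cf cg x; apply: cvgM; [exact: cf|exact: cg]. Qed.

Lemma continuous01Z c f : continuous01 f -> continuous01 (fun x => c * f x).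
Proof. by move=> cf; apply: continuous01M => //; exact: continuous01_cst. Qed.

Lemma continuous01_measurable f : continuous01 f -> measurable_fun unitI f.
Proof. by move=> cf; exact: subspace_continuous_measurable_fun. Qed.

Lemma continuous01_integrable f : continuous01 f -> integrable01 f.
Proof.
by move=> cf; apply: continuous_compact_integrable => //; exact: compact_unitI.
Qed.

Lemma continuous01_bounded f : continuous01 f ->
  exists2 M : R, 0 < M & forall x, unitI x -> `|f x| <= M.
Proof.
move=> cf; have /compact_bounded := continuous_compact cf compact_unitI.
move=> [M [Mr]] /(_ (Num.max M 0 + 1)) fM.
exists (Num.max M 0 + 1); first by rewrite ltr_wpDl// le_max lexx orbT.
move=> x Ix; apply: fM; last by exists x.
by rewrite (@le_lt_trans _ _ (Num.max M 0)) ?ltrDl// le_max lexx.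
Qed.

Lemma eq_int01 f g : (forall x, unitI x -> f x = g x) -> int01 f = int01 g.
Proof. by move=> fg; apply: eq_Rintegral => x /set_mem; exact: fg. Qed.

Lemma eq_integrable01 f g : (forall x, unitI x -> f x = g x) ->
  integrable01 f -> integrable01 g.
Proof.
move=> fg; apply: eq_integrable => // x /set_mem Ix.
by rewrite /= fg.
Qed.

Lemma integrable01D f g : integrable01 f -> integrable01 g ->
  integrable01 (fun x => f x + g x).
Proof.
move=> intf intg; rewrite /integrable01.
by have := integrableD measurable_unitI intf intg.
Qed.

Lemma integrable01Z c f : integrable01 f -> integrable01 (fun x => c * f x).
Proof.
move=> intf; rewrite /integrable01.
by have := integrableZl measurable_unitI c intf.
Qed.

Lemma int01D f g : integrable01 f -> integrable01 g ->
  int01 (fun x => f x + g x) = int01 f + int01 g.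
Proof. exact: RintegralD. Qed.

Lemma int01B f g : integrable01 f -> integrable01 g ->
  int01 (fun x => f x - g x) = int01 f - int01 g.
Proof. exact: RintegralB. Qed.

Lemma int01Z c f : integrable01 f -> int01 (fun x => c * f x) = c * int01 f.
Proof. exact: RintegralZl. Qed.

Lemma int01_ge0 f : (forall x, unitI x -> 0 <= f x) -> 0 <= int01 f.
Proof. by move=> f0; apply: Rintegral_ge0 => x Ix; exact: f0. Qed.

Lemma ler_int01 f g : integrable01 f -> integrable01 g ->
  (forall x, unitI x -> f x <= g x) -> int01 f <= int01 g.
Proof. exact: le_Rintegral. Qed.

Lemma int01_cst c : int01 (fun=> c) = c.
Proof.
have -> : int01 (fun=> c) = c * fine (mu unitI) by exact: Rintegral_cst.
by rewrite /unitI lebesgue_measure_itv/= lte_fin ltr01 -EFinB subr0 mulr1.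
Qed.

Lemma int01_gt0 f : continuous01 f -> (forall x, unitI x -> 0 < f x) ->
  0 < int01 f.
Proof.
move=> cf f0; have [c c01 fc] := EVT_min ler01 cf.
rewrite (@lt_le_trans _ _ (f c)) ?f0// -[leLHS]int01_cst.
apply: ler_int01.
- exact/continuous01_integrable/continuous01_cst.
- exact: continuous01_integrable.
- by move=> x; exact: fc.
Qed.

Lemma L2_measurable f : L2 f -> measurable_fun unitI f.
Proof. by case. Qed.

Lemma L2_integrableX2 f : L2 f -> integrable01 (fun x => f x ^+ 2).
Proof. by case. Qed.

Lemma L2_integrableM f g : L2 f -> L2 g -> integrable01 (fun x => f x * g x).
Proof.
move=> [mf f2] [mg g2].
apply: (@le_integrable _ _ _ _ _ measurable_unitI _
  (EFin \o (fun x => f x ^+ 2 + g x ^+ 2))).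
- by apply/measurable_EFinP; exact: measurable_funM.
- move=> x _ /=; rewrite lee_fin normrM (ger0_norm (addr_ge0 _ _)) ?sqr_ge0//.
  rewrite -(real_normK (num_real (f x))) -(real_normK (num_real (g x))).
  have := sqr_ge0 (`|f x| - `|g x|); have := mulr_ge0 (normr_ge0 (f x)) (normr_ge0 (g x)).
  nra.
- exact: integrable01D.
Qed.

Lemma L2_continuous01 f : continuous01 f -> L2 f.
Proof.
move=> cf; split; first exact: continuous01_measurable.
by apply: (@continuous01_integrable (fun x => f x ^+ 2)); exact: continuous01M.
Qed.

Lemma L2_cst c : L2 (fun=> c).
Proof. exact/L2_continuous01/continuous01_cst. Qed.

Lemma L2_integrable f : L2 f -> integrable01 f.
Proof.
move=> f2; apply: eq_integrable01 (L2_integrableM f2 (L2_cst 1)) => x _.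
by rewrite mulr1.
Qed.

Lemma L2D f g : L2 f -> L2 g -> L2 (fun x => f x + g x).
Proof.
move=> f2 g2; split; first by apply: measurable_funD; exact: L2_measurable.
apply: (@eq_integrable01 (fun x => f x ^+ 2 + g x ^+ 2 + 2 * (f x * g x))).
  by move=> x _; ring.
apply: integrable01D; last exact/integrable01Z/L2_integrableM.
by apply: integrable01D; exact: L2_integrableX2.
Qed.

Lemma L2M f g : continuous01 g -> L2 f -> L2 (fun x => g x * f x).
Proof.
move=> cg f2; have [M M0 gM] := continuous01_bounded cg.
have mgf : measurable_fun unitI (fun x => g x * f x).
  by apply: measurable_funM; [exact: continuous01_measurable|exact: L2_measurable].
split => //; apply: (@le_integrable _ _ _ _ _ measurable_unitI _
  (EFin \o (fun x => M ^+ 2 * f x ^+ 2))).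
- by apply/measurable_EFinP; exact: measurable_funX.
- move=> x Ix /=; rewrite lee_fin -exprMn !ger0_norm ?sqr_ge0// !exprMn ler_wpM2r ?sqr_ge0//.
  by rewrite -(real_normK (num_real (g x))) ler_pXn2r ?nnegrE ?(ltW M0)// gM.
- exact/integrable01Z/L2_integrableX2.
Qed.

Lemma L2Z c f : L2 f -> L2 (fun x => c * f x).
Proof. exact/L2M/continuous01_cst. Qed.

Lemma L2B f g : L2 f -> L2 g -> L2 (fun x => f x - g x).
Proof.
move=> f2 g2; have -> : (fun x => f x - g x) = (fun x => f x + (-1) * g x).
  by apply/funext => x; rewrite mulN1r.
by apply: L2D => //; exact: L2Z.
Qed.

Lemma L2_sum (I : Type) (r : seq I) (F : I -> R -> R) :
  (forall i, L2 (F i)) -> L2 (fun x => \sum_(i <- r) F i x).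
Proof.
move=> F2; elim: r => [|i r IHr].
  under eq_fun do rewrite big_nil.
  exact: L2_cst.
by under eq_fun do rewrite big_cons; exact: L2D.
Qed.

Lemma L2norm_ge0 f : 0 <= L2norm f.
Proof. exact: sqrtr_ge0. Qed.

Lemma sqr_L2norm f : L2norm f ^+ 2 = int01 (fun x => f x ^+ 2).
Proof. by rewrite sqr_sqrtr// int01_ge0// => x _; exact: sqr_ge0. Qed.

Lemma eq_L2norm f g : (forall x, unitI x -> f x = g x) -> L2norm f = L2norm g.
Proof. by move=> fg; congr Num.sqrt; apply: eq_int01 => x Ix; rewrite fg. Qed.

Lemma L2norm_cst c : L2norm (fun=> c) = `|c|.
Proof. by rewrite /L2norm int01_cst sqrtr_sqr. Qed.

(** The scalar [c] is kept because it plays two roles: the variable of the quadratic behind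
    Cauchy-Schwarz, and minus an eigencoefficient when one eigenfunction is subtracted. *)
Lemma sqr_L2normD c f g : L2 f -> L2 g ->
  L2norm (fun x => f x + c * g x) ^+ 2 =
  L2norm f ^+ 2 + 2 * c * int01 (fun x => f x * g x) + c ^+ 2 * L2norm g ^+ 2.
Proof.
move=> f2 g2; rewrite !sqr_L2norm.
rewrite -int01Z; last exact: L2_integrableM.
rewrite -int01Z; last exact: L2_integrableX2.
rewrite -int01D; last 2 first.
- exact: L2_integrableX2.
- exact/integrable01Z/L2_integrableM.
rewrite -int01D; last 2 first.
- apply: integrable01D; first exact: L2_integrableX2.
  exact/integrable01Z/L2_integrableM.
- exact/integrable01Z/L2_integrableX2.
by apply: eq_int01 => x _; ring.
Qed.

Lemma cauchy_schwarz01 f g : L2 f -> L2 g ->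
  `|int01 (fun x => f x * g x)| <= L2norm f * L2norm g.
Proof.
move=> f2 g2; have f0 := L2norm_ge0 f; have g0 := L2norm_ge0 g.
rewrite -(@ler_pXn2r _ 2%N) ?nnegrE ?mulr_ge0// real_normK ?num_real// exprMn.
apply: quadratic_ge0_discriminant => [|c]; first exact: sqr_ge0.
by rewrite -sqr_L2normD// sqr_ge0.
Qed.

Lemma ler_L2normD c f g : L2 f -> L2 g ->
  L2norm (fun x => f x + c * g x) <= L2norm f + `|c| * L2norm g.
Proof.
move=> f2 g2; have f0 := L2norm_ge0 f; have g0 := L2norm_ge0 g.
rewrite -(@ler_pXn2r _ 2%N) ?nnegrE ?addr_ge0 ?mulr_ge0 ?L2norm_ge0//.
rewrite sqr_L2normD// sqrrD exprMn real_normK ?num_real//.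
rewrite lerD2r lerD2l.
have := ler_wpM2l (normr_ge0 c) (cauchy_schwarz01 f2 g2); rewrite -normrM => cfg.
have := ler_norm (c * int01 (fun x => f x * g x)); lra.
Qed.

End Integrals.
#[local] Hint Resolve measurable_unitI unitI0 unitI1 : core.

(** * One-sided derivatives and the fundamental theorem of calculus *)

Section DerivativesOnUnitInterval.
Variable R : realType.
Implicit Types (f g : R -> R) (x y c : R).
Local Notation mu := (@lebesgue_measure R).

Lemma eq_fcvg (T : Type) (F : set_system T) (f g : T -> R) (l : R) :
  f =1 g -> f @ F --> l -> g @ F --> l.
Proof. by move=> /funext ->. Qed.

(** Close to [x] the difference quotient is at most [|f' x| + 1] in modulus, so increments of [f]
    are at most a constant times [|y - x|]. *)
Lemma deriv_on_continuous01 f f' : deriv_on unitI f f' -> continuous01 f.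
Proof.
move=> df; apply/continuous01P => x Ix; apply/cvgrPdist_le => e e0.
have /cvgrPdist_le/(_ 1 ltr01) := df x Ix.
rewrite !near_withinE => dq.
near=> y => Iy; have [->|yx] := eqVneq y x; first by rewrite subrr normr0 ltW.
have yx0 : `|y - x| != 0 by rewrite normr_eq0 subr_eq0.
have q1 : `|f' x - (f y - f x) / (y - x)| <= 1 by move: yx Iy; near: y.
have q2 : `|(f y - f x) / (y - x)| <= `|f' x| + 1.
  have := ler_distD (f' x) ((f y - f x) / (y - x)) 0.
  rewrite !subr0 distrC; lra.
have d0 : 0 < `|f' x| + 1 by rewrite ltr_wpDl.
have : `|x - y| <= e / (`|f' x| + 1).
  by near: y; apply: cvgr_dist_le; rewrite ?divr_gt0//; exact: cvg_id.
rewrite ler_pdivlMr// mulrC => yxe; rewrite distrC; apply: le_trans yxe.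
by rewrite -[leLHS](mulfVK yx0) -normrV ?unitfE ?subr_eq0// -normrM distrC ler_wpM2r// distrC.
Unshelve. all: by end_near. Qed.

Lemma continuous01_dnbhs f x : continuous01 f -> unitI x ->
  f @ within unitI (dnbhs x) --> f x.
Proof.
move=> /continuous01P cf Ix; apply: cvg_trans (cf x Ix) => A /=.
rewrite !nbhs_filterE /= /dnbhs /within /= => fA.
by move: fA; apply: filterS => y + _.
Qed.

Lemma deriv_on_cst c : deriv_on unitI (fun=> c) (fun=> 0).
Proof.
move=> x _; under eq_fun do rewrite subrr mul0r.
exact: cvg_cst.
Qed.

Lemma deriv_onD f f' g g' : deriv_on unitI f f' -> deriv_on unitI g g' ->
  deriv_on unitI (fun x => f x + g x) (fun x => f' x + g' x).
Proof.
move=> df dg x Ix; apply: eq_fcvg (cvgD (df x Ix) (dg x Ix)) => y.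
by rewrite fctE; ring.
Qed.

Lemma deriv_onM f f' g g' : deriv_on unitI f f' -> deriv_on unitI g g' ->
  deriv_on unitI (fun x => f x * g x) (fun x => f' x * g x + f x * g' x).
Proof.
move=> df dg x Ix.
have dfg : (fun y => (f y - f x) / (y - x) * g y + f x * ((g y - g x) / (y - x)))
    @ within unitI (dnbhs x) --> f' x * g x + f x * g' x.
  apply: cvgD; apply: cvgM.
  - exact: df.
  - exact: continuous01_dnbhs (deriv_on_continuous01 dg) Ix.
  - exact: cvg_cst.
  - exact: dg.
by apply: eq_fcvg dfg => y; ring.
Qed.

Lemma deriv_onZ c f f' : deriv_on unitI f f' ->
  deriv_on unitI (fun x => c * f x) (fun x => c * f' x).
Proof.
move=> df; have := deriv_onM (deriv_on_cst c) df.
by under [X in deriv_on _ _ X]eq_fun do rewrite mul0r add0r.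
Qed.

Lemma deriv_onB f f' g g' : deriv_on unitI f f' -> deriv_on unitI g g' ->
  deriv_on unitI (fun x => f x - g x) (fun x => f' x - g' x).
Proof.
move=> df dg; have := deriv_onD df (@deriv_onZ (-1) _ _ dg).
by under eq_fun do rewrite mulN1r; under [X in deriv_on _ _ X]eq_fun do rewrite mulN1r.
Qed.

Lemma deriv_on_sum (I : Type) (r : seq I) (F F' : I -> R -> R) :
  (forall i, deriv_on unitI (F i) (F' i)) ->
  deriv_on unitI (fun x => \sum_(i <- r) F i x) (fun x => \sum_(i <- r) F' i x).
Proof.
have nilE (G : I -> R -> R) : (fun x => \sum_(i <- [::]) G i x) = fun=> 0.
  by apply/funext => x; rewrite big_nil.
have consE (G : I -> R -> R) i s : (fun x => \sum_(j <- i :: s) G j x) =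
    fun x => G i x + \sum_(j <- s) G j x.
  by apply/funext => x; rewrite big_cons.
move=> dF; elim: r => [|i r IHr]; first by rewrite !nilE; exact: deriv_on_cst.
by rewrite !consE; exact: deriv_onD.
Qed.

(** Common ground for the two notions of derivative, two-sided [is_derive] and relative [deriv_on]:
    in this form they pass into each other in the interior of [0,1]. *)
Lemma is_derive_epsdelta f x l : is_derive x (1 : R) f l <->
  forall e : R, 0 < e -> exists2 d : R, 0 < d & forall y, y != x -> `|x - y| < d ->
    `|l - (f y - f x) / (y - x)| <= e.
Proof.
have quotE y : (y - x)^-1 *: (f (y - x + x) - f x) = (f y - f x) / (y - x).
  by rewrite subrK mulrC.
have E : (fun h : R => h^-1 *: ((f \o shift x) (h *: (1 : R)) - f x)) =
         (fun h : R => h^-1 *: (f (h + x) - f x)).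
  by apply/funext => h /=; rewrite [_ *: 1]mulr1.
split=> [dfx e e0|H].
  have : (fun h => h^-1 *: (f (h + x) - f x)) @ 0^' --> l.
    rewrite -E -(@derive_val _ _ _ _ _ _ _ dfx).
    by have /cvg_ex[l' dl] : derivable f x 1 by []; exact: (cvgP l').
  move=> /cvgrPdist_le/(_ e e0); rewrite /dnbhs !near_withinE => /nbhs_ballP[d d0 dq].
  exists d => // y yx xyd; rewrite -quotE; apply: dq; last by rewrite subr_eq0.
  by rewrite /ball/= sub0r normrN distrC.
have dl : (fun h => h^-1 *: (f (h + x) - f x)) @ 0^' --> l.
  apply/cvgrPdist_le => e e0; have [d d0 dq] := H e e0.
  rewrite /dnbhs near_withinE; apply/nbhs_ballP; exists d => // h /=.
  rewrite /ball /= sub0r normrN => hd h0.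
  have := dq (h + x); rewrite -quotE addrK; apply.
    by rewrite -subr_eq0 addrK.
  by rewrite opprD addrCA subrr addr0 normrN.
rewrite -E in dl; split; first by apply/cvg_ex; exists l.
exact: cvg_lim dl.
Qed.

Lemma deriv_on_epsdelta (D : set R) f f' : deriv_on D f f' <->
  forall x, D x -> forall e : R, 0 < e -> exists2 d : R, 0 < d &
    forall y, D y -> y != x -> `|x - y| < d ->
    `|f' x - (f y - f x) / (y - x)| <= e.
Proof.
split=> [df x Dx e e0|H x Dx].
  have /cvgrPdist_le/(_ e e0) := df x Dx.
  rewrite /dnbhs !near_withinE => /nbhs_ballP[d d0 dq].
  by exists d => // y Dy yx xyd; apply: dq.
apply/cvgrPdist_le => e e0; have [d d0 dq] := H x Dx e e0.
rewrite /dnbhs !near_withinE; apply/nbhs_ballP; exists d => // y xyd yx Dy.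
exact: dq.
Qed.

Lemma is_derive_deriv_on f f' :
  (forall x, is_derive x (1 : R) f (f' x)) -> deriv_on unitI f f'.
Proof.
move=> df; apply/deriv_on_epsdelta => x _ e e0.
by have /is_derive_epsdelta/(_ e e0)[d d0 dq] := df x; exists d => // y _; exact: dq.
Qed.

Lemma deriv_on_is_derive f f' x : deriv_on unitI f f' -> 0 < x < 1 ->
  is_derive x (1 : R) f (f' x).
Proof.
move=> /deriv_on_epsdelta df /andP[x0 x1]; apply/is_derive_epsdelta => e e0.
have /df/(_ e e0)[d d0 dq] : unitI x by apply/unitIP; rewrite !ltW.
(* The radius is cut down so that the two-sided neighbourhood stays inside [0,1]. *)
exists (Num.min d (Num.min x (1 - x))); first by rewrite !lt_min d0 x0 subr_gt0.
move=> y yx; rewrite !lt_min => /and3P[xyd].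
rewrite !ltr_norml => /andP[? ?] /andP[? ?]; apply: dq => //.
by apply/unitIP/andP; split; lra.
Qed.

Lemma continuous01_sub f a b : continuous01 f -> 0 <= a -> b <= 1 ->
  {within `[a, b], continuous f}.
Proof.
move=> cf a0 b1; apply: continuous_subspaceW cf => x /=.
by rewrite in_itv/= => /andP[ax xb]; apply/unitIP; rewrite (le_trans a0)//= (le_trans xb).
Qed.

Lemma deriv_on_FTC2 F f a b : deriv_on unitI F f -> continuous01 f ->
  0 <= a -> a <= b -> b <= 1 ->
  \int[mu]_(x in `[a, b]) f x = F b - F a.
Proof.
move=> dF cf a0; rewrite le_eqVlt => /predU1P[<- _|ab b1].
  by rewrite set_itv1 Rintegral_set1 subrr.
have cF := deriv_on_continuous01 dF.
have dF' x : x \in `]a, b[ -> is_derive x (1 : R) F (f x).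
  rewrite in_itv/= => /andP[ax xb]; apply: deriv_on_is_derive => //.
  by rewrite (le_lt_trans a0)//= (lt_le_trans xb).
rewrite /Rintegral (@continuous_FTC2 _ f F)//.
- exact: continuous01_sub.
- have [_ Fa Fb] := (continuous_within_itvP _ ab).1 (continuous01_sub cF a0 b1).
  by split => // x /dF'.
- by move=> x /dF' dx; rewrite derive1E derive_val.
Qed.

Lemma int01_deriv F f : deriv_on unitI F f -> continuous01 f ->
  int01 f = F 1 - F 0.
Proof. by move=> dF cf; rewrite -(deriv_on_FTC2 dF cf). Qed.

Lemma int01_by_parts f f' g g' : deriv_on unitI f f' -> continuous01 f' ->
  deriv_on unitI g g' -> continuous01 g' ->
  int01 (fun x => f x * g' x) =
  f 1 * g 1 - f 0 * g 0 - int01 (fun x => f' x * g x).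
Proof.
move=> df cf' dg cg'.
have cf := deriv_on_continuous01 df; have cg := deriv_on_continuous01 dg.
have cf'g := continuous01M cf' cg; have cfg' := continuous01M cf cg'.
rewrite -(int01_deriv (deriv_onM df dg) (continuous01D cf'g cfg')).
by rewrite int01D; [rewrite [X in X - _]addrC addrK|exact: continuous01_integrable..].
Qed.

(** Indicators turn integrals over subintervals into pairings on [0,1], to which Cauchy-Schwarz
    applies. *)
Lemma L2_indic x y : L2 (\1_(`[x, y]) : R -> R).
Proof.
split; first exact: measurable_indic.
apply: (@eq_integrable01 _ (\1_(`[x, y]))).
  by move=> z _; rewrite /indic expr2 -natrM mulnb andbb.
apply: (@le_integrable _ _ _ _ _ (@measurable_unitI R) _ (cst 1%E)).
- by apply/measurable_EFinP; exact: measurable_indic.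
- by move=> z _ /=; rewrite lee_fin normr1 indicE; case: (_ \in _); rewrite ?normr1 ?normr0.
- exact: (@continuous01_integrable _ (fun=> 1) (@continuous01_cst _ _)).
Qed.

Lemma int01_indicM x y f : 0 <= x -> y <= 1 ->
  int01 (fun z => \1_(`[x, y]) z * f z) = \int[mu]_(z in `[x, y]) f z.
Proof.
move=> x0 y1; have xyI : `[x, y] `<=` (unitI : set R).
  move=> z /=; rewrite in_itv/= => /andP[xz zy].
  by apply/unitIP; rewrite (le_trans x0)//= (le_trans zy).
rewrite -(setIidr xyI) Rintegral_mkcondr; apply: eq_Rintegral => z _.
by rewrite /patch indicE setIidr//; case: ifPn => _; rewrite ?mul1r ?mul0r.
Qed.

Lemma int01_indic x y : 0 <= x -> x <= y -> y <= 1 ->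
  int01 (\1_(`[x, y]) : R -> R) = y - x.
Proof.
move=> x0 xy y1; rewrite -(@eq_int01 _ (fun z => \1_(`[x, y]) z * 1)); last first.
  by move=> z _; rewrite mulr1.
rewrite int01_indicM//.
have -> : \int[mu]_(z in `[x, y]) 1 = 1 * fine (mu `[x, y]) by exact: Rintegral_cst.
rewrite mul1r lebesgue_measure_itv/= lte_fin.
by move: xy; rewrite le_eqVlt => /predU1P[->|->]//; rewrite ltxx subrr.
Qed.

Lemma L2norm_indic x y : 0 <= x -> x <= y -> y <= 1 ->
  L2norm (\1_(`[x, y]) : R -> R) = Num.sqrt (y - x).
Proof.
move=> x0 xy y1; rewrite -(int01_indic x0 xy y1); congr Num.sqrt.
by apply: eq_int01 => z _; rewrite /indic expr2 -natrM mulnb andbb.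
Qed.

(** The increment of [F] is the pairing of [f] with the indicator of the interval between the two
    points, whose L2 norm is the square root of its length. *)
Lemma holder_half F f : deriv_on unitI F f -> continuous01 f ->
  forall x y, unitI x -> unitI y -> `|F y - F x| <= Num.sqrt `|y - x| * L2norm f.
Proof.
move=> dF cf x y /unitIP/andP[x0 x1] /unitIP/andP[y0 y1].
wlog xy : x y x0 x1 y0 y1 / x <= y.
  move=> H; have [/H|/ltW/H] := leP x y; first exact.
  by rewrite distrC (distrC y); apply.
rewrite -(deriv_on_FTC2 dF cf x0 xy y1) -int01_indicM//.
rewrite (le_trans (cauchy_schwarz01 (@L2_indic x y) (L2_continuous01 cf)))//.
by rewrite L2norm_indic// ger0_norm ?subr_ge0.
Qed.

End DerivativesOnUnitInterval.

(** * Weak derivatives *)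

Section WeakDerivatives.
Variable R : realType.
Implicit Types (f g h H k : R -> R) (x y c d : R).
Local Notation mu := (@lebesgue_measure R).

(** Retraction of the line onto [0,1]. Test functions live on the whole line, while values outside
    [0,1] are arbitrary; composing with it extends a function continuous on [0,1] continuously. *)
Definition clamp01 x : R := Num.max 0 (Num.min 1 x).

Lemma clamp01_unitI x : unitI (clamp01 x).
Proof. by apply/unitIP; rewrite /clamp01 le_max lexx ge_max ler01 ge_min lexx. Qed.

Lemma clamp01_id x : unitI x -> clamp01 x = x.
Proof. by move=> /unitIP/andP[x0 x1]; rewrite /clamp01 (min_idPr x1) (max_idPr x0). Qed.

Lemma clamp01_continuous : continuous clamp01.
Proof.
move=> x; apply: (@continuous_max _ _ (fun=> 0) (fun x => Num.min 1 x)).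
  exact: cvg_cst.
apply: (@continuous_min _ _ (fun=> 1) id); [exact: cvg_cst|exact: cvg_id].
Qed.

Lemma continuous_clamp01 f : continuous01 f -> continuous (fun x => f (clamp01 x)).
Proof.
move=> /continuous01P cf x; have Ix := clamp01_unitI x.
apply: (@cvg_trans _ (f @ within unitI (nbhs (clamp01 x)))); last exact: cf.
move=> A fA; have := @clamp01_continuous x _ fA.
rewrite !nbhs_filterE /=; apply: filterS => y /=; apply.
exact: clamp01_unitI.
Qed.

Lemma continuous_continuous01 f : continuous f -> continuous01 f.
Proof. exact: continuous_subspaceT. Qed.

(** The primitive from minus infinity vanishes left of [a] because [k] does, and right of [b]
    because the total integral is zero. This is why a zero mean has to be arranged before a function
    can serve as the derivative of a test function. *)
Lemma test_function_primitive k a b : continuous k -> 0 < a -> b < 1 ->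
  (forall x, ~ (a <= x <= b) -> k x = 0) -> int01 k = 0 ->
  exists phi, [/\ test_function phi, forall x, is_derive x (1 : R) phi (k x) &
    phi 0 = 0].
Proof.
move=> ck a0 b1 k0 ik.
pose phi x : R := \int[mu]_(t in `]-oo, x]) k t.
have kT : k = k \_ unitI.
  apply/funext => x; rewrite /patch; case: ifPn => // /negP xI.
  apply: k0 => /andP[ax xb]; apply: xI; apply/mem_set/unitIP.
  by rewrite (le_trans (ltW a0))//= (le_trans xb)// ltW.
have intk : mu.-integrable setT (EFin \o k).
  rewrite kT -restrict_EFin; apply/(integrable_mkcond _ (@measurable_unitI R)).
  by apply: continuous01_integrable; exact: continuous_continuous01.
have dphi x : is_derive x (1 : R) phi (k x).
  have [|||d1 d2] := @continuous_FTC1 R k -oo%O x (x + 1) _ _ _ (ck x).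
  - by rewrite ltrDl.
  - by apply: integrableS intk.
  - by rewrite ltNyr.
  by split; [exact: d1|rewrite -derive1E; exact: d2].
have phi_a x : x < a -> phi x = 0.
  move=> xa; rewrite /phi Rintegral_mkcond (_ : _ \_ _ = cst 0).
    by rewrite /Rintegral integral0.
  apply/funext => y; rewrite /patch; case: ifPn => // /set_mem/=.
  by rewrite in_itv/= => yx; apply: k0; rewrite leNgt (le_lt_trans yx xa).
have phi_b x : b < x -> phi x = 0.
  move=> bx; rewrite -ik /phi /int01 Rintegral_mkcond [RHS]Rintegral_mkcond -kT.
  congr Rintegral; apply/funext => y; rewrite /patch; case: ifPn => // /negP xy.
  rewrite k0// => /andP[_ yb]; apply: xy; apply/mem_set; rewrite /= in_itv/=.
  by rewrite (le_trans yb)// ltW.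
exists phi; split => //; last exact: phi_a.
split.
- by move=> x; case: (dphi x).
- rewrite (_ : derive1 phi = k)//; apply/funext => x.
  by rewrite derive1E (@derive_val _ _ _ _ _ _ _ (dphi x)).
- exists a, b; split => // x /negP; rewrite negb_and -!ltNge => /orP[]; [exact: phi_a|exact: phi_b].
Qed.

(** For small [d], a trapezoid: zero within distance [d] of the endpoints, one beyond distance
    [2 * d], affine in between. *)
Definition cutoff d x : R :=
  Num.max 0 (Num.min 1 (Num.min x (1 - x) / d - 1)).

Lemma cutoff_continuous d : continuous (cutoff d).
Proof.
move=> x; apply: (@continuous_max _ _ (fun=> 0)
  (fun x => Num.min 1 (Num.min x (1 - x) / d - 1))); first exact: cvg_cst.
apply: (@continuous_min _ _ (fun=> 1) (fun x => Num.min x (1 - x) / d - 1)).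
  exact: cvg_cst.
apply: cvgB; last exact: cvg_cst.
apply: cvgM; last exact: cvg_cst.
apply: (@continuous_min _ _ id (fun x => 1 - x)); first exact: cvg_id.
by apply: cvgB; [exact: cvg_cst|exact: cvg_id].
Qed.

Lemma cutoff_ge0 d x : 0 <= cutoff d x.
Proof. by rewrite /cutoff le_max lexx. Qed.

Lemma cutoff_le1 d x : cutoff d x <= 1.
Proof. by rewrite /cutoff ge_max ler01 ge_min lexx. Qed.

Lemma cutoff_eq0 d x : 0 < d -> ~ (d <= x <= 1 - d) -> cutoff d x = 0.
Proof.
move=> d0 /negP; rewrite negb_and -!ltNge => xd.
rewrite /cutoff; apply/max_idPl; rewrite ge_min subr_le0 ler_pdivrMr// mul1r ge_min.
by case/orP: xd => xd; apply/orP; right; apply/orP; [left|right]; lra.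
Qed.

Lemma cutoff_ge d x : 0 < d -> unitI x ->
  1 - cutoff d x <= \1_(`[0, 2 * d]) x + \1_(`[1 - 2 * d, 1]) x.
Proof.
move=> d0 /unitIP/andP[x0 x1]; rewrite !indicE !mem_setE !in_itv/= x0 x1 andbT/=.
have [x2|x2] := leP x (2 * d).
  by rewrite lerBlDr (_ : true%:R = 1)// -addrA lerDl addr_ge0// cutoff_ge0.
have [x3|x3] := leP (1 - 2 * d) x.
  by rewrite lerBlDr (_ : true%:R = 1)// add0r lerDl cutoff_ge0.
rewrite addr0 subr_le0 /cutoff le_max; apply/orP; right.
by rewrite le_min lexx/= lerBrDl ler_pdivlMr// le_min; apply/andP; split; lra.
Qed.

Lemma int01_cutoff_ge d : 0 < d -> 2 * d <= 1 ->
  int01 (fun x => 1 - cutoff d x) <= 4 * d.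
Proof.
move=> d0 d1; have i2 x y : integrable01 (\1_(`[x, y]) : R -> R).
  exact/L2_integrable/L2_indic.
have -> : 4 * d = int01 (\1_(`[0, 2 * d])) + int01 (\1_(`[1 - 2 * d, 1])).
  by rewrite !int01_indic; lra.
rewrite -int01D//; apply: ler_int01.
- apply: continuous01_integrable; apply: continuous01B.
    exact: continuous01_cst.
  by apply: continuous_continuous01; exact: cutoff_continuous.
- exact: integrable01D.
- by move=> x; exact: cutoff_ge.
Qed.

(** Since [1 - cutoff d] has values in [0,1], its square is at most itself, and its integral is at
    most the total length [4 * d] of the two end zones. *)
Lemma L2norm_cutoff d M h : 0 < d -> 2 * d <= 1 -> 0 <= M -> continuous01 h ->
  (forall x, unitI x -> `|h x| <= M) ->
  L2norm (fun x => (1 - cutoff d x) * h x) <= M * Num.sqrt (4 * d).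
Proof.
move=> d0 d1 M0 ch hM.
have c1 : continuous01 (fun x => 1 - cutoff d x).
  apply: continuous01B; first exact: continuous01_cst.
  by apply: continuous_continuous01; exact: cutoff_continuous.
rewrite -(ger0_norm M0) -sqrtr_sqr -sqrtrM ?sqr_ge0// ler_wsqrtr//.
apply: (@le_trans _ _ (int01 (fun x => M ^+ 2 * (1 - cutoff d x)))); last first.
  rewrite int01Z; last exact: continuous01_integrable.
  by rewrite ler_wpM2l ?sqr_ge0// int01_cutoff_ge.
apply: ler_int01.
- by apply: L2_integrableX2; apply: L2_continuous01; exact: continuous01M.
- by apply: integrable01Z; exact: continuous01_integrable.
move=> x Ix; rewrite exprMn mulrC.
have k0 := cutoff_ge0 d x; have k1 := cutoff_le1 d x.
have hM2 : h x ^+ 2 <= M ^+ 2.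
  by rewrite -(real_normK (num_real (h x))) ler_pXn2r ?nnegrE// hM.
have : (1 - cutoff d x) ^+ 2 <= 1 - cutoff d x by nra.
have := sqr_ge0 (1 - cutoff d x); have := sqr_ge0 (h x).
nra.
Qed.

(* [h] is replaced by the compactly supported [cutoff d * h] plus a multiple of
   a fixed bump restoring the zero mean; its primitive is a test function close
   to [H]. *)
Lemma weak_derivative_by_parts f g h H : L2 f -> weak_derivative f g ->
  deriv_on unitI H h -> continuous01 h -> H 0 = 0 -> H 1 = 0 ->
  int01 (fun x => f x * h x) = - int01 (fun x => g x * H x).
Proof.
move=> f2 [g2 fg] dH ch H0 H1.
have [M M0 hM] := continuous01_bounded ch.
have cH := deriv_on_continuous01 dH.
have cc d : continuous01 (cutoff d).
  by apply: continuous_continuous01; exact: cutoff_continuous.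
(* With width 1/16 the cutoff loses at most 1/4 of the unit mass, so the bump has mass at least
   3/4. *)
pose b := int01 (cutoff (16%:R^-1)).
have b0 : 0 < b.
  have : int01 (fun x => 1 - cutoff (16%:R^-1) x) <= 4 * 16%:R^-1.
    by apply: int01_cutoff_ge; lra.
  rewrite int01B ?int01_cst -/b; first lra.
    exact/continuous01_integrable/continuous01_cst.
  exact: continuous01_integrable.
pose bump x := b^-1 * cutoff (16%:R^-1) x.
have cbump : continuous01 bump by exact: continuous01Z.
have ibump : int01 bump = 1.
  by rewrite int01Z ?mulVf ?gt_eqF//; exact: continuous01_integrable.
have ih : int01 h = 0 by rewrite (int01_deriv dH)// H0 H1 subrr.
set L := int01 _; set L' := int01 _.
pose C := (L2norm f + L2norm g) * ((1 + L2norm bump) * M).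
have C0 : 0 <= C.
  by rewrite /C !mulr_ge0 ?addr_ge0 ?L2norm_ge0// ltW.
(* The total error is linear in [s], and [s] can be taken arbitrarily small, which forces
   [L + L' = 0]. *)
suff bound s : 0 < s -> s <= 2^-1 -> `|L + L'| <= C * s.
  have [|LL0] := leP `|L + L'| 0.
    by rewrite normr_le0 addr_eq0 => /eqP.
  have C1 : 0 < 2 * (C + 1) by rewrite mulr_gt0// ltr_wpDl.
  have := bound (Num.min 2^-1 (`|L + L'| / (2 * (C + 1)))).
  rewrite lt_min ge_min lexx invr_gt0 ltr0n divr_gt0// => /(_ isT isT).
  have : Num.min 2^-1 (`|L + L'| / (2 * (C + 1))) <= `|L + L'| / (2 * (C + 1)).
    by rewrite ge_min lexx orbT.
  rewrite ler_pdivlMr//; set m := Num.min _ _ => h1 h2.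
  have m0 : 0 <= m by rewrite /m le_min invr_ge0 ler0n/= divr_ge0// ltW.
  have := mulr_ge0 C0 m0; lra.
(* Chosen so that [Num.sqrt (4 * d) = s]; and [s <= 1/2] gives [d <= 1/16], so the bump is supported
   in [[d, 1 - d]] too. *)
move=> s0 s1; pose d := s ^+ 2 / 4.
have d0 : 0 < d by rewrite divr_gt0// exprn_gt0.
have d1 : d <= 16%:R^-1 by rewrite /d; nra.
have sd : Num.sqrt (4 * d) = s by rewrite /d mulrC mulfVK// sqrtr_sqr gtr0_norm.
pose m := int01 (fun x => cutoff d x * h x).
have cr : continuous01 (fun x => (1 - cutoff d x) * h x).
  apply: continuous01M => //; apply: continuous01B => //.
  exact: continuous01_cst.
have nr : L2norm (fun x => (1 - cutoff d x) * h x) <= M * s.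
  by rewrite -sd; apply: L2norm_cutoff => //; [lra|exact: ltW].
(* As [H] vanishes at both ends, [h] has mean zero, so the mean of the truncated [h] comes from the
   removed part only and is of order [s]. *)
have mE : - m = int01 (fun x => 1 * ((1 - cutoff d x) * h x)).
  rewrite -[LHS]add0r -ih -int01B; last 2 first.
  - exact: continuous01_integrable.
  - by apply: continuous01_integrable; exact: continuous01M.
  by apply: eq_int01 => x _; ring.
have mM : `|m| <= M * s.
  rewrite -normrN mE; apply: le_trans nr.
  rewrite (le_trans (cauchy_schwarz01 (@L2_cst _ 1) (L2_continuous01 cr)))//.
  by rewrite L2norm_cst normr1 mul1r.
pose k x := cutoff d x * h (clamp01 x) - m * bump x.
have ck : continuous k.
  move=> x; apply: cvgB; apply: cvgM.
  - exact: cutoff_continuous.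
  - exact: continuous_clamp01.
  - exact: cvg_cst.
  - by apply: cvgM; [exact: cvg_cst|exact: cutoff_continuous].
have ck01 := continuous_continuous01 ck.
have kE x : unitI x -> k x = cutoff d x * h x - m * bump x.
  by move=> Ix; rewrite /k clamp01_id.
have k0 x : ~ (d <= x <= 1 - d) -> k x = 0.
  move=> xd; rewrite /k /bump !cutoff_eq0 ?mul0r ?mulr0 ?subr0 ?invr_gt0//.
  by move=> /andP[? ?]; apply: xd; apply/andP; split; lra.
have ik : int01 k = 0.
  rewrite (eq_int01 kE) int01B; last 2 first.
  - by apply: continuous01_integrable; exact: continuous01M.
  - by apply: continuous01_integrable; exact: continuous01Z.
  rewrite int01Z ?ibump ?mulr1 ?subrr//; exact: continuous01_integrable.
have d1' : 1 - d < 1 by lra.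
have [phi [tphi dphi phi0]] := test_function_primitive ck d0 d1' k0 ik.
have dphi01 := is_derive_deriv_on dphi.
have cphi := deriv_on_continuous01 dphi01.
have ckh : continuous01 (fun x => h x - k x) by exact: continuous01B.
have nkh : L2norm (fun x => h x - k x) <= (1 + L2norm bump) * M * s.
  rewrite (@eq_L2norm _ _ (fun x => (1 - cutoff d x) * h x + m * bump x)).
    apply: le_trans (ler_L2normD _ _ _) _.
    - exact: L2_continuous01.
    - exact: L2_continuous01.
    have := ler_wpM2r (L2norm_ge0 bump) mM; nra.
  by move=> x Ix; rewrite kE//; ring.
(* [H - phi] is the primitive of [h - k] vanishing at 0, so its supremum, and with it its L2 norm,
   is bounded by the L2 norm of [h - k]. *)
have nHphi : L2norm (fun x => H x - phi x) <= (1 + L2norm bump) * M * s.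
  apply: le_trans nkh; rewrite -[leRHS]ger0_norm ?L2norm_ge0// -sqrtr_sqr.
  rewrite -[X in _ <= Num.sqrt X]int01_cst ler_wsqrtr//; apply: ler_int01.
  - apply: L2_integrableX2; apply: L2_continuous01; exact: continuous01B.
  - exact/continuous01_integrable/continuous01_cst.
  move=> x Ix; rewrite -(real_normK (num_real (H x - _))) ler_pXn2r ?nnegrE ?L2norm_ge0//.
  have := holder_half (deriv_onB dH dphi01) ckh (@unitI0 R) Ix.
  rewrite H0 phi0 !subr0 => /le_trans; apply.
  rewrite -[leRHS]mul1r ler_wpM2r ?L2norm_ge0// -sqrtr1 ler_wsqrtr//.
  by move/unitIP: Ix => /andP[x0 x1]; rewrite ger0_norm.
have fk := fg phi tphi.
have {}fk : int01 (fun x => f x * k x) = - int01 (fun x => g x * phi x).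
  rewrite -fk; apply: eq_int01 => x _; congr (_ * _).
  by rewrite derive1E (@derive_val _ _ _ _ _ _ _ (dphi x)).
(* The relation for the test function [phi] cancels the main terms; only the two approximation
   errors remain. *)
have -> : L + L' = int01 (fun x => f x * (h x - k x)) + int01 (fun x => g x * (H x - phi x)).
  have E F h1 h2 : L2 F -> continuous01 h1 -> continuous01 h2 ->
      int01 (fun x => F x * (h1 x - h2 x)) = int01 (fun x => F x * h1 x) - int01 (fun x => F x * h2 x).
    move=> F2 /L2_continuous01 c1 /L2_continuous01 c2.
    rewrite -int01B; [|exact: L2_integrableM..].
    by apply: eq_int01 => x _; rewrite mulrBr.
  by rewrite (E f h k)// (E g H phi)// fk -/L -/L' opprK addrACA [_ + - _]addrC addNr addr0.
rewrite (le_trans (ler_normD _ _))// /C.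
have e1 := cauchy_schwarz01 f2 (L2_continuous01 ckh).
have e2 := cauchy_schwarz01 g2 (L2_continuous01 (continuous01B cH cphi)).
have e3 := ler_wpM2l (L2norm_ge0 f) nkh; have e4 := ler_wpM2l (L2norm_ge0 g) nHphi.
lra.
Qed.

Lemma deriv_on_weak_derivative f f' : deriv_on unitI f f' -> continuous01 f' ->
  weak_derivative f f'.
Proof.
move=> df cf'; split=> [|phi [dphi cphi [a [b [a0 b1 phi0]]]]].
  exact: L2_continuous01.
have dphi01 : deriv_on unitI phi (derive1 phi).
  by apply: is_derive_deriv_on => x; rewrite derive1E; exact: derivableP.
rewrite (int01_by_parts df cf' dphi01 (continuous_continuous01 cphi)).
by rewrite !phi0 ?mulr0 ?subrr ?sub0r// => /andP[? ?]; lra.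
Qed.

Lemma weak_derivativeD f f' g g' c : L2 f -> L2 g ->
  weak_derivative f f' -> weak_derivative g g' ->
  weak_derivative (fun x => f x + c * g x) (fun x => f' x + c * g' x).
Proof.
move=> f2 g2 [f'2 ff'] [g'2 gg']; split=> [|phi tphi].
  by apply: L2D => //; exact: L2Z.
have E u u' v : L2 u -> L2 u' -> continuous v ->
    int01 (fun x => (u x + c * u' x) * v x) =
    int01 (fun x => u x * v x) + c * int01 (fun x => u' x * v x).
  move=> u2 u'2 cv; have v2 := L2_continuous01 (continuous_continuous01 cv).
  rewrite -int01Z; last exact: L2_integrableM.
  rewrite -int01D; [|exact: L2_integrableM|exact/integrable01Z/L2_integrableM].
  by apply: eq_int01 => x _; ring.
have cphi : continuous phi.
  by move=> x; apply: differentiable_continuous; apply/derivable1_diffP; case: tphi.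
have [_ cdphi _] := tphi.
by rewrite !E// ff'// gg'// mulrN -opprD.
Qed.

End WeakDerivatives.

(** * Eigenfunction expansions *)

Lemma eq_deriv_on (R : realType) (D : set R) (f f' g' : R -> R) :
  (forall x, D x -> f' x = g' x) -> deriv_on D f f' -> deriv_on D f g'.
Proof. by move=> fg df x Dx; rewrite -fg//; exact: df. Qed.

Section Eigenbasis.
Variables (R : realType) (V : R -> R) (mu : nat -> R) (e : nat -> R -> R).
Hypotheses (cV : continuous01 V) (V_gt0 : forall x, unitI x -> 0 < V x).
Hypothesis mu_e : neumann_eigenbasis mu e V.
Implicit Types (f g : R -> R) (x y c : R) (n N : nat).

(** The second derivative is replaced by [(V - mu n) * e n] through the eigenvalue equation: this
    expression is continuous because [V] and [e n] are, as integration by parts requires. *)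
Lemma eigen_derivatives : exists de : nat -> R -> R, forall n,
  [/\ deriv_on unitI (e n) (de n),
      deriv_on unitI (de n) (fun x => (V x - mu n) * e n x),
      de n 0 = 0 & de n 1 = 0].
Proof.
suff /choice[de deP] : forall n, exists d, [/\ deriv_on unitI (e n) d,
    deriv_on unitI d (fun x => (V x - mu n) * e n x), d 0 = 0 & d 1 = 0].
  by exists de.
move=> n; have [f' [f'' [df df' [f0 f1] eq]]] := eigen_fun mu_e n.
exists f'; split => //; apply: eq_deriv_on df' => x Ix.
by have := eq x Ix; lra.
Qed.

Lemma continuous01_eigen n : continuous01 (e n).
Proof.
by have [de /(_ n)[d _ _ _]] := eigen_derivatives; exact: deriv_on_continuous01 d.
Qed.
Local Hint Resolve continuous01_eigen : core.

Lemma L2_eigen n : L2 (e n).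
Proof. exact: L2_continuous01. Qed.
Local Hint Resolve L2_eigen : core.

Lemma eigenvalue_ge0 n : 0 <= mu n.
Proof.
have mu0 := ltW (eigen_gt0 mu_e); case: n => [//|n].
have mu1 := le_trans mu0 (ltW (eigen_gap mu_e)).
by elim: n => // n IHn; rewrite (le_trans IHn)// (eigen_mono mu_e).
Qed.

Lemma eigenvalue1_le n : (0 < n)%N -> mu 1%N <= mu n.
Proof.
case: n => // n _; elim: n => // n IHn.
by rewrite (le_trans IHn)// (eigen_mono mu_e).
Qed.

Lemma eigen_coefD n f g c : L2 f -> L2 g ->
  coef e n (fun x => f x + c * g x) = coef e n f + c * coef e n g.
Proof.
move=> f2 g2; rewrite /coef -int01Z; last exact: L2_integrableM.
rewrite -int01D; [|exact: L2_integrableM|exact/integrable01Z/L2_integrableM].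
by apply: eq_int01 => x _; ring.
Qed.

Lemma coef_eigen n m : coef e n (e m) = (n == m)%:R.
Proof. exact: (eigen_orthonormal mu_e). Qed.

Lemma L2norm_eigen n : L2norm (e n) = 1.
Proof.
rewrite /L2norm -[RHS]sqrtr1; congr Num.sqrt.
by rewrite -[RHS]/((true)%:R) -(eqxx n) -(eigen_orthonormal mu_e).
Qed.

Lemma ler_coef n f : L2 f -> `|coef e n f| <= L2norm f.
Proof.
move=> f2; rewrite (le_trans (cauchy_schwarz01 (L2_eigen n) f2))//.
by rewrite L2norm_eigen mul1r.
Qed.

Definition eigen_rem f N x := f x - \sum_(n < N) coef e n f * e n x.

Lemma eigen_rem0 f : eigen_rem f 0 = f.
Proof. by apply/funext => x; rewrite /eigen_rem big_ord0 subr0. Qed.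

(** The form [f + c * g] matches the expansions of the L2 norm and of the energy, so the identities
    below go by removing one eigenfunction at a time. *)
Lemma eigen_remS f N :
  eigen_rem f N.+1 = fun x => eigen_rem f N x + (- coef e N f) * e N x.
Proof. by apply/funext => x; rewrite /eigen_rem big_ord_recr/=; ring. Qed.

Lemma L2_eigen_rem f N : L2 f -> L2 (eigen_rem f N).
Proof.
move=> f2; elim: N => [|N IHN]; first by rewrite eigen_rem0.
by rewrite eigen_remS; apply: L2D => //; exact: L2Z.
Qed.

Lemma coef_eigen_rem f N n : L2 f -> (N <= n)%N ->
  coef e n (eigen_rem f N) = coef e n f.
Proof.
move=> f2; elim: N => [|N IHN] Nn; first by rewrite eigen_rem0.
rewrite eigen_remS eigen_coefD//; last exact: L2_eigen_rem.
by rewrite coef_eigen gtn_eqF// mulr0 addr0 IHN// ltnW.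
Qed.

(** The remainder still has the coefficient [coef e N f] along [e N]; subtracting that component
    changes the squared norm by minus twice its square plus its square. *)
Lemma bessel f N : L2 f ->
  L2norm (eigen_rem f N) ^+ 2 = L2norm f ^+ 2 - \sum_(n < N) coef e n f ^+ 2.
Proof.
move=> f2; elim: N => [|N IHN]; first by rewrite eigen_rem0 big_ord0 subr0.
rewrite eigen_remS sqr_L2normD//; last exact: L2_eigen_rem.
rewrite L2norm_eigen IHN big_ord_recr/=.
rewrite (_ : int01 _ = coef e N f); first by ring.
rewrite -(@coef_eigen_rem f N N)//; apply: eq_int01 => x _.
by rewrite mulrC.
Qed.

(** Bessel's inequality with the ground state removed. Applied to the initial datum and to the
    constant 1, it produces the two norms in [koopman_ratio]. *)
Lemma sum_coef_sqr_le f N : L2 f ->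
  \sum_(0 <= n < N) coef e n.+1 f ^+ 2 <=
  L2norm (fun x => f x - coef e 0 f * e 0 x) ^+ 2.
Proof.
move=> f2; have := sqr_ge0 (L2norm (eigen_rem f N.+1)).
rewrite bessel// big_ord_recl/= -(big_mkord xpredT (fun n => coef e n.+1 f ^+ 2)).
have := bessel 1 f2; rewrite big_ord_recl big_ord0 addr0/= => b1.
have -> : L2norm (fun x => f x - coef e 0 f * e 0 x) = L2norm (eigen_rem f 1).
  by apply: eq_L2norm => x _; rewrite /eigen_rem big_ord_recl big_ord0 addr0.
by rewrite b1 subr_ge0 lerBrDl.
Qed.

(** The error is the pairing of the remainder of [f] with [g]; Cauchy-Schwarz and completeness make
    it tend to zero. *)
Lemma parseval f g : L2 f -> L2 g ->
  (fun N => \sum_(n < N) coef e n f * coef e n g) @ \oo --> int01 (fun x => f x * g x).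
Proof.
move=> f2 g2; apply/cvgrPdist_le => eps eps0.
have g0 := L2norm_ge0 g.
have e1 : 0 < eps / (L2norm g + 1) by rewrite divr_gt0// ltr_wpDl.
have /cvgrPdist_le/(_ _ e1) := eigen_complete mu_e f2.
apply: filterS => N; rewrite sub0r normrN ger0_norm ?L2norm_ge0//.
rewrite -[L2norm _]/(L2norm (eigen_rem f N)) ler_pdivlMr ?ltr_wpDl// => fN.
have -> : int01 (fun x => f x * g x) - \sum_(n < N) coef e n f * coef e n g =
    int01 (fun x => eigen_rem f N x * g x).
  elim: N {fN} => [|N IHN]; first by rewrite eigen_rem0 big_ord0 subr0.
  rewrite big_ord_recr/= opprD addrA IHN eigen_remS.
  have -> : int01 (fun x => (eigen_rem f N x + - coef e N f * e N x) * g x) =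
      int01 (fun x => eigen_rem f N x * g x - coef e N f * (e N x * g x)).
    by apply: eq_int01 => x _; ring.
  rewrite int01B; last 2 first.
  - by apply: L2_integrableM => //; exact: L2_eigen_rem.
  - by apply: integrable01Z; exact: L2_integrableM.
  by rewrite int01Z//; exact: L2_integrableM.
rewrite (le_trans (cauchy_schwarz01 (L2_eigen_rem N f2) g2))//.
have := L2norm_ge0 (eigen_rem f N); nra.
Qed.

(** The quadratic form of the operator [-f'' + V f], in weak form. The weak derivative is a separate
    argument [g] since [f] determines it only almost everywhere. *)
Definition energy f g := L2norm g ^+ 2 + int01 (fun x => V x * f x * f x).

Lemma energy_ge f g : L2norm g ^+ 2 <= energy f g.
Proof.
rewrite lerDl int01_ge0// => x Ix; rewrite -mulrA -expr2 mulr_ge0 ?sqr_ge0// ltW//.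
exact: V_gt0.
Qed.

Section WithDerivatives.
Variable de : nat -> R -> R.
Hypothesis deP : forall n,
  [/\ deriv_on unitI (e n) (de n),
      deriv_on unitI (de n) (fun x => (V x - mu n) * e n x),
      de n 0 = 0 & de n 1 = 0].

Let continuous01_de n : continuous01 (de n).
Proof. by have [_ d _ _] := deP n; exact: deriv_on_continuous01 d. Qed.
Local Hint Resolve continuous01_de : core.

Let L2_de n : L2 (de n).
Proof. exact: L2_continuous01. Qed.
Local Hint Resolve L2_de : core.

(** Weak form of the eigenvalue equation. The derivative of [e n] vanishes at the endpoints by the
    Neumann conditions, which is what the extended integration by parts asks for; [f] itself
    satisfies no boundary condition. *)
Lemma energy_form_eigen f g n : L2 f -> weak_derivative f g ->
  int01 (fun x => g x * de n x) + int01 (fun x => V x * f x * e n x) =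
  mu n * coef e n f.
Proof.
move=> f2 fg; have [_ dde de0 de1] := deP n.
have cVe : continuous01 (fun x => (V x - mu n) * e n x).
  by apply: continuous01M => //; apply: continuous01B => //; exact: continuous01_cst.
have -> : int01 (fun x => g x * de n x) = - int01 (fun x => f x * ((V x - mu n) * e n x)).
  by rewrite (weak_derivative_by_parts f2 fg dde cVe de0 de1) opprK.
rewrite addrC -int01B; last 2 first.
- by apply: L2_integrableM => //; exact: L2M.
- by apply: L2_integrableM => //; exact: L2_continuous01.
rewrite -int01Z; last exact: L2_integrableM.
by apply: eq_int01 => x _; ring.
Qed.

Lemma energyD f g n c : L2 f -> weak_derivative f g ->
  energy (fun x => f x + c * e n x) (fun x => g x + c * de n x) =
  energy f g + 2 * c * (mu n * coef e n f) + c ^+ 2 * mu n.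
Proof.
move=> f2 fg; have [g2 _] := fg.
(* The eigenfunction [e n] itself has energy [mu n]; the cross term comes from the weak eigenvalue
   equation. *)
have ee : mu n = L2norm (de n) ^+ 2 + int01 (fun x => V x * e n x * e n x).
  have [de1 _ _ _] := deP n.
  have := energy_form_eigen n (L2_eigen n) (deriv_on_weak_derivative de1 (@continuous01_de n)).
  by rewrite coef_eigen eqxx mulr1 => <-; rewrite sqr_L2norm.
rewrite -(energy_form_eigen n f2 fg) [X in c ^+ 2 * X]ee /energy.
rewrite sqr_L2normD//.
have -> : int01 (fun x => V x * (f x + c * e n x) * (f x + c * e n x)) =
    int01 (fun x => V x * f x * f x + (2 * c * (V x * f x * e n x) +
      c ^+ 2 * (V x * e n x * e n x))).
  by apply: eq_int01 => x _; ring.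
have i1 u v : L2 u -> L2 v -> integrable01 (fun x => V x * u x * v x).
  by move=> u2 v2; apply: L2_integrableM => //; exact: L2M.
rewrite int01D; last 2 first.
- exact: i1.
- by apply: integrable01D; apply: integrable01Z; exact: i1.
rewrite int01D; [|by apply: integrable01Z; exact: i1..].
rewrite int01Z; last exact: i1.
rewrite int01Z; last exact: i1.
ring.
Qed.

Let dsum f N x := \sum_(n < N) coef e n f * de n x.

Lemma weak_derivative_eigen_rem f g N : L2 f -> weak_derivative f g ->
  weak_derivative (eigen_rem f N) (fun x => g x - dsum f N x).
Proof.
move=> f2 fg; elim: N => [|N IHN].
  rewrite eigen_rem0; congr weak_derivative: fg.
  by apply/funext => x; rewrite /dsum big_ord0 subr0.
have [de1 _ _ _] := deP N.
have := weak_derivativeD (- coef e N f) (L2_eigen_rem N f2) (L2_eigen N) IHN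
  (deriv_on_weak_derivative de1 (@continuous01_de N)).
rewrite -eigen_remS; congr weak_derivative.
by apply/funext => x; rewrite /dsum big_ord_recr/=; ring.
Qed.

(** Bessel's identity for the energy: each component removed lowers it by [mu n] times the squared
    coefficient. *)
Lemma energy_eigen_rem f g N : L2 f -> weak_derivative f g ->
  energy (eigen_rem f N) (fun x => g x - dsum f N x) =
  energy f g - \sum_(n < N) mu n * coef e n f ^+ 2.
Proof.
move=> f2 fg; elim: N => [|N IHN].
  rewrite eigen_rem0 big_ord0 subr0; congr energy.
  by apply/funext => x; rewrite /dsum big_ord0 subr0.
have -> : (fun x => g x - dsum f N.+1 x) =
    fun x => g x - dsum f N x + (- coef e N f) * de N x.
  by apply/funext => x; rewrite /dsum big_ord_recr/=; ring.
rewrite eigen_remS energyD; last 2 first.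
- exact: L2_eigen_rem.
- exact: weak_derivative_eigen_rem.
by rewrite IHN coef_eigen_rem// big_ord_recr/=; ring.
Qed.

(** The sum is [g] minus the derivative of the remainder. Both have squared norm at most the energy
    of [f], because nonnegative eigenvalues make the energy of the remainders no larger. The bound
    does not depend on [N]. *)
Lemma L2norm_dsum f g N : L2 f -> weak_derivative f g ->
  L2norm (dsum f N) <= 2 * Num.sqrt (energy f g).
Proof.
move=> f2 fg; have [g2 _] := fg.
have d2 : L2 (dsum f N) by apply: L2_sum => n; exact: L2Z.
have le_en v : L2norm v ^+ 2 <= energy f g -> L2norm v <= Num.sqrt (energy f g).
  by move=> h; rewrite -[leLHS]ger0_norm ?L2norm_ge0// -sqrtr_sqr ler_wsqrtr.
have := ler_L2normD (-1) g2 (L2B g2 d2).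
rewrite (@eq_L2norm _ _ (dsum f N)); last by move=> x _; ring.
rewrite normrN1 mul1r => /le_trans; apply.
rewrite mulrDl mul1r lerD//; apply: le_en; first exact: energy_ge.
rewrite (le_trans (energy_ge (eigen_rem f N) _))// energy_eigen_rem//.
rewrite lerBlDr lerDl sumr_ge0// => n _.
by rewrite mulr_ge0 ?eigenvalue_ge0// sqr_ge0.
Qed.

End WithDerivatives.

(* The energy bound makes the partial sums 1/2-Hoelder uniformly in [N], so that
   the remainders are equicontinuous and L2 convergence becomes pointwise. *)
Lemma eigen_expansion_pointwise f x : H1 f -> unitI x ->
  (fun N => \sum_(n < N) coef e n f * e n x) @ \oo --> f x.
Proof.
move=> [cf f2 [g fg]] Ix; have [de deP] := eigen_derivatives.
pose K := 2 * Num.sqrt (energy f g) + 1.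
have K0 : 0 < K by rewrite ltr_wpDl// mulr_ge0// sqrtr_ge0.
have cde n : continuous01 (de n).
  by have [_ d _ _] := deP n; exact: deriv_on_continuous01 d.
have holder N y : unitI y ->
    `|\sum_(n < N) coef e n f * e n y - \sum_(n < N) coef e n f * e n x| <=
    Num.sqrt `|y - x| * K.
  move=> Iy; have dS : deriv_on unitI (fun y => \sum_(n < N) coef e n f * e n y)
      (fun y => \sum_(n < N) coef e n f * de n y).
    by apply: deriv_on_sum => n; apply: deriv_onZ; have [] := deP n.
  have cS : continuous01 (fun y => \sum_(n < N) coef e n f * de n y).
    have dS' : deriv_on unitI (fun y => \sum_(n < N) coef e n f * de n y)
        (fun y => \sum_(n < N) coef e n f * ((V y - mu n) * e n y)).
      by apply: deriv_on_sum => n; apply: deriv_onZ; have [] := deP n.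
    exact: deriv_on_continuous01 dS'.
  rewrite (le_trans (holder_half dS cS Ix Iy))// ler_wpM2l ?sqrtr_ge0//.
  rewrite (le_trans (L2norm_dsum deP N f2 fg))// /K.
  by rewrite lerDl.
apply/cvgrPdist_le => eps3 eps3_gt0; pose eps := eps3 / 3.
have eps0 : 0 < eps by rewrite divr_gt0.
have [d1 d10 fd1] : exists2 d : R, 0 < d &
    forall y, unitI y -> `|x - y| < d -> `|f x - f y| <= eps.
  have /continuous01P/(_ x Ix)/cvgrPdist_le/(_ eps eps0) := cf.
  rewrite near_withinE => /nbhs_ballP[d d0 fd].
  by exists d => // y Iy xy; apply: fd.
(* [d1] controls the oscillation of [f], [(eps / K) ^+ 2] that of every partial sum, and [2^-1] lets
   an interval of length [d] fit in [0,1] on one side of [x], even at an endpoint. *)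
pose d := Num.min (d1 / 2) (Num.min ((eps / K) ^+ 2) 2^-1).
have d0 : 0 < d by rewrite !lt_min invr_gt0 ltr0n exprn_gt0 ?divr_gt0.
have dd1 : d < d1.
  have : d <= d1 / 2 by rewrite ge_min lexx.
  by move: d10; lra.
have dK : Num.sqrt d * K <= eps.
  have eK0 : 0 <= eps / K by rewrite divr_ge0// ltW.
  rewrite -ler_pdivlMr// -[leRHS]ger0_norm// -sqrtr_sqr ler_wsqrtr//.
  by rewrite !ge_min lexx/= orbT.
have d2 : d <= 2^-1 by rewrite !ge_min lexx !orbT.
(* Half the least L2 norm of a function that is at least [eps] in modulus on an interval of length
   [d]. *)
have e1 : 0 < eps * Num.sqrt d / 2 by rewrite !mulr_gt0 ?sqrtr_gt0 ?invr_gt0.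
have /cvgrPdist_le/(_ _ e1) := eigen_complete mu_e f2.
apply: filterS => N; rewrite sub0r normrN ger0_norm ?L2norm_ge0//.
rewrite -[L2norm _]/(L2norm (eigen_rem f N)) -[X in `|X|]/(eigen_rem f N x) => rN.
(* If the remainder exceeded [3 * eps] at [x], it would stay above [eps] on an interval of length
   [d], since [f] and the partial sum each vary by at most [eps] there; its L2 norm would then be
   too large. *)
rewrite leNgt; apply/negP => rx.
have [a [b [a0 b1 ab xab]]] : exists a b : R, [/\ 0 <= a, b <= 1, b - a = d &
    forall y, a <= y <= b -> `|x - y| <= d].
  have /unitIP/andP[x0 x1] := Ix.
  have [x2|x2] := leP x 2^-1.
    exists x, (x + d); split; [lra|lra|lra|].
    by move=> y /andP[? ?]; rewrite distrC ger0_norm; lra.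
  exists (x - d), x; split; [lra|lra|lra|].
  by move=> y /andP[? ?]; rewrite ger0_norm; lra.
have ab' : a <= b by lra.
have r_ge y : a <= y <= b -> eps <= `|eigen_rem f N y|.
  move=> yab; have Iy : unitI y.
    by move: yab => /andP[? ?]; apply/unitIP/andP; split; lra.
  have xyd := xab y yab.
  have h1 := holder N y Iy; have h2 := fd1 y Iy (le_lt_trans xyd dd1).
  have h3 : Num.sqrt `|y - x| * K <= eps.
    by apply: le_trans dK; rewrite ler_wpM2r ?(ltW K0)// ler_wsqrtr// distrC.
  have : `|eigen_rem f N x - eigen_rem f N y| <= eps + eps.
    rewrite (_ : _ - _ = (f x - f y) +
        (\sum_(n < N) coef e n f * e n y - \sum_(n < N) coef e n f * e n x)).
      by rewrite (le_trans (ler_normD _ _))// lerD// (le_trans h1).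
    by rewrite /eigen_rem; ring.
  have := ler_distD (eigen_rem f N y) (eigen_rem f N x) 0; rewrite !subr0.
  move: rx; rewrite /eps; lra.
have : eps ^+ 2 * d <= L2norm (eigen_rem f N) ^+ 2.
  rewrite sqr_L2norm -ab -(int01_indic a0 ab' b1) -int01Z; last first.
    exact/L2_integrable/L2_indic.
  apply: ler_int01.
  - exact/integrable01Z/L2_integrable/L2_indic.
  - exact/L2_integrableX2/L2_eigen_rem.
  move=> y Iy; rewrite indicE mem_setE in_itv/=.
  case: (boolP (a <= y <= b)) => [/r_ge ry|_]; last by rewrite mulr0 sqr_ge0.
  rewrite mulr1 -[leRHS]real_normK ?num_real// ler_pXn2r ?nnegrE// ltW//.
have : L2norm (eigen_rem f N) ^+ 2 <= (eps * Num.sqrt d / 2) ^+ 2.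
  by rewrite ler_pXn2r ?nnegrE ?L2norm_ge0// ltW.
have -> : (eps * Num.sqrt d / 2) ^+ 2 = eps ^+ 2 * d / 4.
  by rewrite -[in RHS](sqr_sqrtr (ltW d0)); field.
move=> h1 h2.
have : 0 < eps ^+ 2 * d by rewrite mulr_gt0// exprn_gt0.
lra.
Qed.

End Eigenbasis.

(** * Evolution of the eigencoefficients *)

Section Dynamics.
Variables (R : realType) (V : R -> R) (mu : nat -> R) (e : nat -> R -> R).
Hypotheses (cV : continuous01 V) (mu_e : neumann_eigenbasis mu e V).
Variables (v0 : R -> R) (v : R -> R -> R).
Hypothesis v_sol : nonlinear_heat_solution V v0 v.
Implicit Types (s t x y : R) (n : nat).

Lemma joint_continuous01 (w : R -> R -> R) t :
  {within `]0, +oo[ `*` unitI, continuous (fun p : R * R => w p.1 p.2)} ->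
  0 < t -> continuous01 (w t).
Proof.
move=> /subspace_continuousP cw t0; apply/continuous01P => x Ix.
have : (fun p : R * R => w p.1 p.2) @ within (`]0, +oo[ `*` unitI) (nbhs (t, x)) --> w t x.
  by apply: (cw (t, x)); split => //=; rewrite in_itv/= t0.
move=> cwt A /cwt; rewrite !nbhs_filterE /= => -[[/= U1 U2] [/= U1t U2x] UA].
apply: filterS U2x => y U2y Iy.
apply: (UA (t, y)); first by split => //=; exact: nbhs_singleton.
by split => //=; rewrite in_itv/= t0.
Qed.

(** Compactness of [[a, b]] times [0,1], with [a] away from the initial time; it supplies the
    dominating constant for differentiation under the integral. *)
Lemma joint_continuous_bounded (w : R -> R -> R) a b :
  {within `]0, +oo[ `*` unitI, continuous (fun p : R * R => w p.1 p.2)} ->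
  0 < a -> exists2 M : R, 0 < M & forall t x, a <= t <= b -> unitI x -> `|w t x| <= M.
Proof.
move=> cw a0.
have cw' : {within `[a, b] `*` unitI, continuous (fun p : R * R => w p.1 p.2)}.
  apply: continuous_subspaceW cw => -[t x] /= [tab Ix]; split => //.
  by move: tab; rewrite !in_itv/= => /andP[ta _]; rewrite (lt_le_trans a0).
have K : compact (`[a, b] `*` unitI : set (R * R)).
  by apply: compact_setX; exact: segment_compact.
have /compact_bounded[M [Mr]] := continuous_compact cw' K.
move=> /(_ (Num.max M 0 + 1)) wM.
exists (Num.max M 0 + 1); first by rewrite ltr_wpDl// le_max lexx orbT.
move=> t x tab Ix; apply: wM; last by exists (t, x).
by rewrite (@le_lt_trans _ _ (Num.max M 0)) ?ltrDl// le_max lexx.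
Qed.

Lemma solution_L2 t : 0 <= t -> L2 (v t).
Proof. by move=> /(heat_P1 v_sol)[[]]. Qed.

Lemma coef_derive n t : 0 < t -> is_derive t (1 : R) (fun s => coef e n (v s))
  ((int01 (fun x => V x * v t x) - mu n) * coef e n (v t)).
Proof.
move=> t0; have [vt [vx [vxx [cw eqn]]]] := heat_equation v_sol.
have cvt : continuous01 (vt t) by apply: joint_continuous01 => //; apply: cw; constructor 2.
have cvxx : continuous01 (vxx t) by apply: joint_continuous01 => //; apply: cw; constructor 4.
have [_ dv dvx [vx0 vx1] veq] := eqn t t0.
have cvx := deriv_on_continuous01 dvx; have cv := deriv_on_continuous01 dv.
have [de deP] := eigen_derivatives mu_e.
have [de1 dde de0 de1'] := deP n.
have cde := deriv_on_continuous01 dde.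
have ce : continuous01 (e n) by exact: continuous01_eigen mu_e _.
have cdde : continuous01 (fun x => (V x - mu n) * e n x).
  by apply: continuous01M => //; apply: continuous01B => //; exact: continuous01_cst.
(* The time window []t / 2, t + 1[] keeps away from 0, so that [vt] is bounded on it. *)
have t2 : 0 < t / 2 by rewrite divr_gt0.
have I_gt0 s : s \in `]t / 2, t + 1[ -> 0 < s.
  by rewrite in_itv/= => /andP[ts _]; exact: lt_trans ts.
have [M M0 vtM] : exists2 M : R, 0 < M &
    forall s x, t / 2 <= s <= t + 1 -> unitI x -> `|vt s x| <= M.
  by apply: joint_continuous_bounded => //; apply: cw; constructor 2.
have [M' M'0 eM] := continuous01_bounded ce.
pose f s y := e n y * v s y.
have df s y : s \in `]t / 2, t + 1[ -> unitI y -> is_derive s (1 : R) (f ^~ y) (e n y * vt s y).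
  move=> /I_gt0 s0 Iy; have [dvt _ _ _ _] := eqn s s0.
  by apply: is_deriveZ; exact: dvt.
have tI : t \in `]t / 2, t + 1[ by rewrite in_itv/=; apply/andP; split; lra.
have intf s : s \in `]t / 2, t + 1[ -> integrable01 (f s).
  move=> /I_gt0 s0; apply: L2_integrableM; first exact: L2_continuous01.
  by apply: solution_L2; exact: ltW.
have derf1 s y : s \in `]t / 2, t + 1[ -> unitI y -> derivable (f ^~ y) s 1.
  by move=> sI Iy; have [] := df s y sI Iy.
have G_ge0 (y : R) : 0 <= M' * M by rewrite mulr_ge0// ltW.
have intG : integrable01 (fun=> M' * M).
  exact/continuous01_integrable/continuous01_cst.
have d1E s y : s \in `]t / 2, t + 1[ -> unitI y -> partial1of2 f s y = e n y * vt s y.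
  move=> sI Iy; rewrite partial1of2E.
  by rewrite (@derive_val _ _ _ _ _ _ _ (df s y sI Iy)).
have G_ub s y : s \in `]t / 2, t + 1[ -> unitI y -> `|partial1of2 f s y| <= M' * M.
  move=> sI Iy; rewrite d1E// normrM ler_pM// ?eM// vtM//.
  by move: sI; rewrite in_itv/= => /andP[? ?]; rewrite !ltW.
have der := @derivable_under_integral R _ _ (@lebesgue_measure R) f unitI
  (@measurable_unitI R) t (t / 2) (t + 1) tI intf derf1 (fun=> M' * M) G_ge0 intG G_ub.
have val := @differentiation_under_integral R _ _ (@lebesgue_measure R) f unitI
  (@measurable_unitI R) t (t / 2) (t + 1) tI intf derf1 (fun=> M' * M) G_ge0 intG G_ub.
have dc : is_derive t (1 : R) (fun s => coef e n (v s)) (int01 (fun x => e n x * vt t x)).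
  split; first exact: der.
  rewrite -derive1E; apply: etrans val _.
  by apply: eq_int01 => y Iy; exact: d1E.
apply: (is_derive_eq dc).
pose N := int01 (fun x => V x * v t x).
(* Both sides reduce to minus the integral of [de n * vx t]: the boundary terms vanish on one side
   by the Neumann conditions of [v t], on the other by those of [e n]. *)
have E1 : int01 (fun x => e n x * vxx t x) = int01 (fun x => v t x * ((V x - mu n) * e n x)).
  rewrite (int01_by_parts de1 cde dvx cvxx) (int01_by_parts dv cvx dde cdde).
  rewrite vx0 vx1 de0 de1' !mulr0 subrr; congr (_ - _).
  by apply: eq_int01 => x _; exact: mulrC.
have -> : int01 (fun x => e n x * vt t x) =
    int01 (fun x => e n x * vxx t x + (N * (e n x * v t x) - e n x * (V x * v t x))).
  by apply: eq_int01 => x Ix; rewrite veq//; rewrite -/N; ring.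
have ev := continuous01M ce cv; have cVv := continuous01M cV cv.
rewrite int01D; last 2 first.
- by apply: continuous01_integrable; exact: continuous01M.
- apply: continuous01_integrable; apply: continuous01B; first exact: continuous01Z.
  exact: continuous01M.
rewrite E1 int01B; last 2 first.
- by apply: continuous01_integrable; exact: continuous01Z.
- by apply: continuous01_integrable; exact: continuous01M.
rewrite int01Z; last exact: continuous01_integrable.
have -> : int01 (fun x => v t x * ((V x - mu n) * e n x)) =
    int01 (fun x => e n x * (V x * v t x) - mu n * (e n x * v t x)).
  by apply: eq_int01 => x _; ring.
rewrite int01B; last 2 first.
- by apply: continuous01_integrable; exact: continuous01M.
- by apply: continuous01_integrable; exact: continuous01Z.
rewrite int01Z; last exact: continuous01_integrable.
rewrite -/N /coef; ring.
Qed.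

Lemma ler_L2norm_H1norm (f : R -> R) : L2norm f <= H1norm f.
Proof.
rewrite /H1norm -[leLHS]ger0_norm ?L2norm_ge0// -sqrtr_sqr ler_wsqrtr//.
by rewrite lerDl sqr_ge0.
Qed.

(** The coefficients are bounded by the L2 norm, hence by the H^1 norm in which the solution is
    continuous. This reaches t = 0, where the equation is not imposed. *)
Lemma coef_continuous n :
  {within `[0, +oo[, continuous (fun t => coef e n (v t))}.
Proof.
apply/subspace_continuousP => s; rewrite /= in_itv/= andbT => s0; apply/cvgrPdist_le => eps eps0.
have /cvgrPdist_le/(_ eps eps0) := heat_continuous v_sol s0.
rewrite !near_withinE; apply: filterS => t h t0; have := h t0.
have {}t0 : 0 <= t by move: t0; rewrite /= in_itv/= andbT.
rewrite sub0r normrN ger0_norm; last exact: sqrtr_ge0.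
have vt2 := solution_L2 t0; have vs2 := solution_L2 s0.
apply: le_trans; apply: le_trans (ler_L2norm_H1norm _).
rewrite distrC -[X in X - _]mul1r.
have -> : 1 * coef e n (v t) - coef e n (v s) = coef e n (fun x => v t x + (-1) * v s x).
  by rewrite (eigen_coefD mu_e)//; ring.
have <- : L2norm (fun x => v t x + (-1) * v s x) = L2norm (v t \- v s).
  by apply: eq_L2norm => x _ /=; ring.
by apply: (ler_coef mu_e); apply: L2D => //; exact: L2Z.
Qed.

Lemma coef0_gt0 (f : R -> R) : P1 f -> 0 < coef e 0 f.
Proof.
move=> [[cf _ _] f0 _]; apply: int01_gt0.
  by apply: continuous01M => //; exact: continuous01_eigen mu_e _.
by move=> x Ix; rewrite mulr_gt0 ?f0// (eigen_pos mu_e).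
Qed.

Lemma coef_ratio n t : 0 <= t ->
  coef e n (v t) / coef e 0 (v t) =
  expR (- (mu n - mu 0%N) * t) * (coef e n (v 0) / coef e 0 (v 0)).
Proof.
move=> t0; pose r s := coef e n (v s) * (coef e 0 (v s))^-1 * expR ((mu n - mu 0%N) * s).
have c0 s : 0 <= s -> 0 < coef e 0 (v s) by move=> s0; apply: coef0_gt0; exact: heat_P1 v_sol s s0.
pose N s := int01 (fun x => V x * v s x).
suff : r t = r 0.
  rewrite /r mulr0 expR0 mulr1 => <-.
  by rewrite mulrCA -expRD mulNr addNr expR0 mulr1.
move: t0; rewrite le_eqVlt => /predU1P[<-//|t0].
(* The factor [N s] is common to the logarithmic derivatives of both coefficients and cancels; the
   exponential in [r] compensates the difference of the eigenvalues. *)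
have dr s : s \in `]0, t[ -> is_derive s (1 : R) r 0.
  rewrite in_itv/= => /andP[s0 _].
  have dn := coef_derive n s0; have d0 := coef_derive 0 s0.
  have c0' : coef e 0 (v s) != 0 by rewrite gt_eqF// c0// ltW.
  have di : is_derive s (1 : R) (fun s => (coef e 0 (v s))^-1)
      (- (coef e 0 (v s)) ^- 2 *: ((N s - mu 0%N) * coef e 0 (v s))).
    case: d0 => d01 d02; split; first exact: derivableV.
    by rewrite deriveV// d02.
  have dk : is_derive s (1 : R) (fun s => (mu n - mu 0%N) * s) ((mu n - mu 0%N) *: 1).
    by apply: is_deriveZ.
  have dE := is_derive1_comp (is_derive_expR ((mu n - mu 0%N) * s)) dk.
  apply: (is_derive_eq (is_deriveM (is_deriveM dn di) dE)).
  rewrite -/(N s) /GRing.scale/= fctE; field; exact: c0'.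
have cr : {within `[0, t], continuous r}.
  have cc m : {within `[0, t], continuous (fun s => coef e m (v s))}.
    apply: continuous_subspaceW (@coef_continuous m).
    by move=> x /=; rewrite !in_itv/= andbT => /andP[].
  apply/subspace_continuousP => s st; have s0 : 0 <= s.
    by move: st; rewrite /= in_itv/= => /andP[].
  apply: cvgM; first apply: cvgM.
  - by have /subspace_continuousP := cc n; apply.
  - by apply: cvgV; [rewrite gt_eqF ?c0|have /subspace_continuousP := cc 0%N; apply].
  - apply: cvg_within_filter; apply: continuous_comp; last exact: continuous_expR.
    by apply: cvgM; [exact: cvg_cst|exact: cvg_id].
have [s _] := MVT t0 dr cr.
by rewrite mul0r => /eqP; rewrite subr_eq0 => /eqP.
Qed.

End Dynamics.

(** * Unconditional sums over tuples *)

Section UnconditionalSums.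
Variable R : realType.

(** A finite set containing [L N] adds to the sum over [L N] at most the missing absolute mass, [T]
    minus the absolute sum over [L N]. So convergence along one exhausting sequence, together with
    that of the absolute sums, gives the unconditional sum. *)
Lemma cvg_partial_sum (I : choiceType) (f : I -> R) (L : nat -> seq I) (S T : R) :
  (forall n, uniq (L n)) ->
  (forall m n, (m <= n)%N -> {subset L m <= L n}) ->
  (forall A : {fset I}, exists n, {subset A <= L n}) ->
  (fun n => \sum_(i <- L n) f i) @ \oo --> S ->
  (fun n => \sum_(i <- L n) `|f i|) @ \oo --> T ->
  summability.partial_sum f @ summability.totally --> S.
Proof.
move=> uL sL exL cS cT; have FF := @summability.totally_filter I.
apply/cvgrPdist_le => eps eps0.
have eps2 : 0 < eps / 2 by rewrite divr_gt0.
have subsum (g : I -> R) (A B : seq I) : uniq A -> uniq B -> {subset A <= B} ->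
    \sum_(i <- A) g i = \sum_(i <- B | i \in A) g i.
  move=> uA uB AB; rewrite -[RHS]big_filter; apply/perm_big/uniq_perm => //.
    exact: filter_uniq.
  by move=> i; rewrite mem_filter andb_idr//; exact: AB.
have T_ge n : \sum_(i <- L n) `|f i| <= T.
  have nd : nondecreasing_seq (fun n => \sum_(i <- L n) `|f i|).
    move=> m k mk; rewrite (subsum _ _ _ (uL m) (uL k) (sL _ _ mk)).
    rewrite [leRHS](bigID (fun i => i \in L m))/= lerDl.
    by apply: sumr_ge0.
  have := nondecreasing_cvgn_le nd (cvgP _ cT) n.
  by rewrite (cvg_lim _ cT).
have /cvgrPdist_le/(_ _ eps2) cS' := cS; have /cvgrPdist_le/(_ _ eps2) cT' := cT.
have [N [SN TN]] : exists N, `|S - \sum_(i <- L N) f i| <= eps / 2 /\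
    `|T - \sum_(i <- L N) `|f i| | <= eps / 2.
  by have [N _ /(_ N (leqnn N))] := filterI cS' cT'; exists N.
exists (seq_fset tt (L N)) => // A LNA.
have /fsubsetP NA : (seq_fset tt (L N) `<=` A)%fset by exact: LNA.
(* A single list containing both [A] and [L N], in which the absolute sums are compared. *)
have [n1 An1] := exL A; pose n := maxn n1 N.
have An : {subset A <= L n} by move=> i /An1; apply: sL; exact: leq_maxl.
have LA : {subset L N <= A} by move=> i iL; apply: NA; rewrite seq_fsetE.
have -> : summability.partial_sum f A = \sum_(i <- A) f i.
  by rewrite /summability.partial_sum big_seq_fsetE.
have key : `|\sum_(i <- A) f i - \sum_(i <- L N) f i| <= eps / 2.
  rewrite (subsum f _ _ (uL N) (fset_uniq A) LA) (bigID (fun i => i \in L N))/=.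
  rewrite addrC addrK (le_trans (ler_norm_sum _ _ _))//.
  apply: (@le_trans _ _ (\sum_(i <- L n | i \notin L N) `|f i|)).
    rewrite [leLHS]big_mkcond/= (subsum _ _ _ (fset_uniq A) (uL n) An) -big_mkcondr.
    rewrite [leRHS](bigID (fun i => i \in A))/= -[leLHS]addr0.
    rewrite lerD ?sumr_ge0// le_eqVlt; apply/orP; left; apply/eqP.
    by apply: eq_bigl => i; rewrite andbC.
  have := T_ge n; rewrite (bigID (fun i => i \in L N))/=.
  rewrite -(subsum _ _ _ (uL N) (uL n) (sL _ _ (leq_maxr _ _))).
  move: TN; rewrite ler_norml => /andP[_]; lra.
rewrite (_ : S - _ = (S - \sum_(i <- L N) f i) -
  (\sum_(i <- A) f i - \sum_(i <- L N) f i)); last by ring.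
by rewrite (le_trans (ler_normB _ _))// [leRHS]splitr lerD.
Qed.

Let pos_nat := {q : nat | (0 < q)%N}.
Let pos_of N (i : 'I_N) : pos_nat := exist _ i.+1 (ltn0Sn i).
(** The tuples with all entries between 1 and [N], listed through functions into ['I_N] so that a
    power of a sum expands over them by distributivity. *)
Let cube m N : seq (m.-tuple pos_nat) :=
  [seq [tuple pos_of (g i) | i < m] | g : {ffun 'I_m -> 'I_N}].

Let cubeP m N (qs : m.-tuple pos_nat) :
  reflect (forall i, (val (tnth qs i) <= N)%N) (qs \in cube m N).
Proof.
apply: (iffP idP) => [/mapP[g _ ->] i|qsN].
  by rewrite tnth_mktuple /= ltn_ord.
have lt i : ((val (tnth qs i)).-1 < N)%N.
  by have := qsN i; case: (tnth qs i) => -[].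
apply/mapP; exists [ffun i => Ordinal (lt i)]; first exact: mem_enum.
apply: eq_from_tnth => i; rewrite tnth_mktuple; apply: val_inj.
by rewrite ffunE /=; case: (tnth qs i) => -[].
Qed.

Let uniq_cube m N : uniq (cube m N).
Proof.
rewrite map_inj_uniq ?enum_uniq// => g h gh; apply/ffunP => i.
have := congr1 (fun t => val (tnth t i)) gh.
by rewrite !tnth_mktuple => -[] /val_inj.
Qed.

Let sum_cube (w : nat -> R) m N :
  \sum_(qs <- cube m N) \prod_(q <- qs) w (val q) = (\sum_(0 <= n < N) w n.+1) ^+ m.
Proof.
rewrite big_map big_enum/= big_mkord.
transitivity (\sum_(g : {ffun 'I_m -> 'I_N}) \prod_(i < m) w (g i).+1).
  by apply: eq_bigr => g _; rewrite /= big_map big_enum.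
by rewrite -(bigA_distr_bigA (fun _ (j : 'I_N) => w j.+1)) prodr_const card_ord.
Qed.

(** Over the cubes, both the sum and the absolute sum are the [m]-th powers of partial sums of one
    series, hence converge. *)
Lemma cvg_tuple_sum (w : nat -> R) (m : nat) (S T : R) :
  series (fun n => w n.+1) @ \oo --> S ->
  series (fun n => `|w n.+1|) @ \oo --> T ->
  summability.partial_sum (fun qs : m.-tuple {q : nat | (0 < q)%N} =>
    \prod_(q <- [seq val q | q <- qs]) w q) @ summability.totally --> S ^+ m.
Proof.
move=> cS cT.
apply: (@cvg_partial_sum _ _ (cube m) _ (T ^+ m)).
- exact: uniq_cube.
- move=> a b ab qs /cubeP qsa; apply/cubeP => i; exact: leq_trans (qsa i) ab.
- move=> A; exists (\max_(qs <- A) \max_(i < m) val (tnth qs i))%N => qs qsA.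
  apply/cubeP => i; apply: (leq_trans _ (@leq_bigmax_seq _ (enum_fset A) xpredT
    (fun qs => \max_(i < m) val (tnth qs i))%N qs qsA isT)).
  exact: (leq_bigmax (F := fun i => val (tnth qs i)) i).
- under eq_fun => n.
    under eq_bigr => qs _ do rewrite big_map.
    rewrite sum_cube.
    over.
  apply: (@cvg_comp _ _ _ (series (fun n => w n.+1)) (fun x => x ^+ m) _ _ _ cS).
  exact: exprn_continuous.
- under eq_fun => n.
    under eq_bigr => qs _ do rewrite big_map normr_prod.
    rewrite (sum_cube (fun n => `|w n|)).
    over.
  apply: (@cvg_comp _ _ _ (series (fun n => `|w n.+1|)) (fun x => x ^+ m) _ _ _ cT).
  exact: exprn_continuous.
Qed.

Lemma cvg_series_bounded_abs (u : nat -> R) (B : R) :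
  (forall N, \sum_(0 <= n < N) `|u n| <= B) ->
  exists S T : R, [/\ series u @ \oo --> S, series (fun n => `|u n|) @ \oo --> T & `|S| <= B].
Proof.
move=> uB.
have cT : cvgn (series (fun n => `|u n|)).
  apply: nondecreasing_is_cvgn.
    by apply: nondecreasing_series => n _ _.
  by exists B => _ [N _ <-]; exact: uB.
have cS : cvgn (series u) by apply: normed_cvg.
exists (limn (series u)), (limn (series (fun n => `|u n|))); split => //.
rewrite -lim_norm//; apply: limr_le; first exact: is_cvg_norm.
by apply: nearW => N; exact: le_trans (ler_norm_sum _ _ _) (uB N).
Qed.

End UnconditionalSums.

(** * The Koopman decomposition *)

(** Cauchy-Schwarz for finite sums, from the nonnegative quadratic
    [c |-> sum (a i + c * b i) ^+ 2]. *)
Lemma sum_mul_le (R : rcfType) (n : nat) (a b : nat -> R) (A B : R) :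
  0 <= A -> 0 <= B ->
  \sum_(0 <= i < n) a i ^+ 2 <= A ^+ 2 -> \sum_(0 <= i < n) b i ^+ 2 <= B ^+ 2 ->
  \sum_(0 <= i < n) a i * b i <= A * B.
Proof.
move=> A0 B0 aA bB.
apply: (le_trans (ler_norm _)).
rewrite -(@ler_pXn2r _ 2%N) ?nnegrE ?mulr_ge0// real_normK ?num_real// exprMn.
have a0 : 0 <= \sum_(0 <= i < n) a i ^+ 2 by apply: sumr_ge0 => i _; exact: sqr_ge0.
have b0 : 0 <= \sum_(0 <= i < n) b i ^+ 2 by apply: sumr_ge0 => i _; exact: sqr_ge0.
apply: (@le_trans _ _ ((\sum_(0 <= i < n) a i ^+ 2) * \sum_(0 <= i < n) b i ^+ 2)).
  apply: quadratic_ge0_discriminant => // c.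
  have -> : \sum_(0 <= i < n) a i ^+ 2 + 2 * c * \sum_(0 <= i < n) a i * b i +
      c ^+ 2 * \sum_(0 <= i < n) b i ^+ 2 = \sum_(0 <= i < n) (a i + c * b i) ^+ 2.
    by rewrite !mulr_sumr -!big_split/=; apply: eq_bigr => i _; ring.
  by apply: sumr_ge0 => i _; exact: sqr_ge0.
exact: ler_pM.
Qed.

Section Koopman.
Variables (R : realType) (V : R -> R) (mu : nat -> R) (e : nat -> R -> R).
Hypotheses (cV : continuous01 V) (V_gt0 : forall x, unitI x -> 0 < V x).
Hypothesis mu_e : neumann_eigenbasis mu e V.
Implicit Types (f : R -> R) (t x : R) (n : nat).

Local Notation C := (int01 (e 0%N)).

Let ce n : continuous01 (e n).
Proof. exact: continuous01_eigen mu_e _. Qed.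

Lemma int01_eigen0_gt0 : 0 < C.
Proof. by apply: int01_gt0 => // x; exact: eigen_pos mu_e x. Qed.

Lemma int01_eigen n : int01 (e n) = coef e n (cst 1).
Proof. by apply: eq_int01 => x _; rewrite /= mulr1. Qed.

Lemma P1_L2 f : P1 f -> L2 f.
Proof. by case=> -[]. Qed.

Lemma koopman_ratio_ge0 f : P1 f -> 0 <= koopman_ratio e f.
Proof.
move=> Pf; rewrite /koopman_ratio mulr_ge0 ?mulr_ge0 ?L2norm_ge0// invr_ge0.
by rewrite mulr_ge0// ltW ?int01_eigen0_gt0 ?(coef0_gt0 mu_e).
Qed.

Lemma koopman_decay_lt1 f t : P1 f -> (tau_ mu e f < t%:E)%E ->
  expR (- (mu 1%N - mu 0%N) * t) * koopman_ratio e f < 1.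
Proof.
move=> Pf; rewrite /tau_; case: eqVneq => [->|r0]; first by rewrite mulr0 ltr01.
have r_gt0 : 0 < koopman_ratio e f by rewrite lt_def r0 koopman_ratio_ge0.
have gap : 0 < mu 1%N - mu 0%N by rewrite subr_gt0; exact: eigen_gap mu_e.
rewrite lte_fin ltr_pdivrMl// => lnr.
rewrite mulNr expRN ltr_pdivrMl ?expR_gt0// mulr1.
by rewrite -[ltLHS]lnK// ltr_expR.
Qed.

(** Along a solution starting at [f], this is the ratio of the coefficients [q] and 0 at time [t],
    expressed by the initial datum. *)
Definition koopman_mode f t (q : nat) : R :=
  expR (- (mu q - mu 0%N) * t) * (coef e q f / coef e 0 f).

(* The sign absorbs the [(-1) ^ m] of [b_]. *)
Definition koopman_weight f t (q : nat) : R := - (koopman_mode f t q * pcoef e q).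

(** The exponent is additive and the eigenfunctional multiplicative over the multi-index, so a term
    factors over its entries; only the first entry involves [x]. *)
Lemma koopman_termE f t x q qs :
  koopman_term mu e f t x (q :: qs) =
  koopman_mode f t q * e q x / C * \prod_(r <- qs) koopman_weight f t r.
Proof.
rewrite /koopman_term /b_ /=.
have -> nu : expR (- lambda_ mu nu * t) * psi_ e nu f = \prod_(r <- nu) koopman_mode f t r.
  elim: nu => [|r nu IHnu].
    by rewrite /lambda_ /psi_ !big_nil oppr0 mul0r expR0 mulr1.
  rewrite big_cons -IHnu /lambda_ /psi_ !big_cons opprD mulrDl expRD.
  by rewrite /koopman_mode; ring.
have -> : \prod_(r <- qs) koopman_weight f t r = (-1) ^+ size qs *
    \prod_(r <- qs) koopman_mode f t r * \prod_(r <- qs) pcoef e r.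
  elim: qs => [|r qs IHqs]; first by rewrite !big_nil !mulr1.
  by rewrite !big_cons IHqs exprS /koopman_weight; ring.
by rewrite big_cons; ring.
Qed.

(** All modes with positive index decay at least as fast as the first, which gives the exponential.
    The integral of [e n] is the coefficient of the constant 1, so the rest is a product of two
    coefficient sequences, bounded by Cauchy-Schwarz and Bessel. *)
Lemma sum_koopman_weight_le f t N : P1 f -> 0 <= t ->
  \sum_(0 <= n < N) `|koopman_weight f t n.+1| <=
  expR (- (mu 1%N - mu 0%N) * t) * koopman_ratio e f.
Proof.
move=> Pf t0; have c0 := coef0_gt0 mu_e Pf; have C0 := int01_eigen0_gt0.
set E := expR _.
have wE n : `|koopman_weight f t n.+1| <=
    E / (coef e 0 f * C) * (`|coef e n.+1 f| * `|coef e n.+1 (cst 1)|).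
  rewrite /koopman_weight /koopman_mode /pcoef int01_eigen normrN !normrM !normfV.
  rewrite (gtr0_norm c0) (gtr0_norm C0) (ger0_norm (expR_ge0 _)).
  have EE : expR (- (mu n.+1 - mu 0%N) * t) <= E.
    rewrite ler_expR ler_wpM2r// lerN2 lerD2r; exact: (eigenvalue1_le mu_e).
  rewrite [leLHS](_ : _ = expR (- (mu n.+1 - mu 0%N) * t) / (coef e 0 f * C) *
    (`|coef e n.+1 f| * `|coef e n.+1 (cst 1)|)); last by field; rewrite !gt_eqF.
  by rewrite ler_wpM2r ?mulr_ge0// ler_wpM2r// invr_ge0 mulr_ge0// ltW.
apply: (le_trans (ler_sum _ (fun n _ => wE n))).
have -> : E * koopman_ratio e f = E / (coef e 0 f * C) *
    (L2norm (fun x => f x - coef e 0 f * e 0 x) *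
     L2norm (fun x => 1 - coef e 0 (cst 1) * e 0 x)).
  by rewrite /koopman_ratio mulrA mulrAC.
have EC : 0 <= E / (coef e 0 f * C).
  by rewrite divr_ge0 ?expR_ge0// mulr_ge0// ltW.
rewrite -mulr_sumr ler_wpM2l//.
apply: sum_mul_le; rewrite ?L2norm_ge0//.
- under eq_bigr do rewrite real_normK ?num_real//.
  exact: (sum_coef_sqr_le mu_e N (P1_L2 Pf)).
- under eq_bigr do rewrite real_normK ?num_real//.
  exact: (sum_coef_sqr_le mu_e N (@L2_cst R 1)).
Qed.

Lemma koopman_decompositionP v0 v t x : P1 v0 -> nonlinear_heat_solution V v0 v ->
  0 <= t -> unitI x ->
  expR (- (mu 1%N - mu 0%N) * t) * koopman_ratio e v0 < 1 ->
  koopman_decomposition mu e v0 t x (v t x).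
Proof.
move=> Pv0 v_sol t0 Ix B1; have C0 := int01_eigen0_gt0.
have Pvt := heat_P1 v_sol t0; have c0 := coef0_gt0 mu_e Pvt.
have [S [T [cS cT SB]]] := cvg_series_bounded_abs
  (fun N => sum_koopman_weight_le N Pv0 t0).
have S1 : `|S| < 1 := le_lt_trans SB B1.
have modeE q : coef e q (v t) = coef e 0 (v t) * koopman_mode v0 t q.
  have init n : coef e n (v 0) = coef e n v0.
    by apply: eq_int01 => y Iy; rewrite (heat_init v_sol).
  have := coef_ratio cV mu_e v_sol q t0.
  by rewrite /koopman_mode !init => <-; rewrite mulrC divfK// gt_eqF.
have mass : coef e 0 (v t) * C * (1 - S) = 1.
  have cvg1 := parseval mu_e (P1_L2 Pvt) (@L2_cst R 1).
  have int1 : int01 (fun y => v t y * 1) = 1.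
    by have [_ _ vt1] := Pvt; apply: etrans vt1; apply: eq_int01 => y _; rewrite mulr1.
  (* The shift splits off the term of index 0, which becomes the 1 in [1 - S]. *)
  rewrite int1 -cvg_shiftS in cvg1.
  have cvg2 : (fun N => coef e 0 (v t) * C * (1 - series (fun n => koopman_weight v0 t n.+1) N))
      @ \oo --> coef e 0 (v t) * C * (1 - S).
    by apply: cvgM; [exact: cvg_cst|apply: cvgB; [exact: cvg_cst|exact: cS]].
  apply: (cvg_unique (@Rhausdorff R) cvg2); apply: eq_fcvg cvg1 => N /=.
  rewrite -(big_mkord xpredT (fun n => coef e n (v t) * coef e n (cst 1))).
  rewrite big_nat_recl// /series/= mulrBr mulr1 -int01_eigen; congr (_ + _).
  rewrite mulr_sumr -sumrN; apply: eq_bigr => n _.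
  rewrite -int01_eigen modeE /koopman_weight /pcoef.
  by field; rewrite gt_eqF.
have invS : (C * (1 - S))^-1 = coef e 0 (v t).
  have S0 : C * (1 - S) != 0.
    by apply/negP => /eqP h; move: mass; rewrite -mulrA h mulr0 => /eqP; rewrite eq_sym oner_eq0.
  by apply: (mulIf S0); rewrite mulVf// mulrA.
exists (fun q m => koopman_mode v0 t q * e q x / C * S ^+ m),
  (fun q => coef e q (v t) * e q x); split.
- move=> q m.
  have -> : summability.partial_sum (fun qs : m.-tuple {q : nat | (0 < q)%N} =>
      koopman_term mu e v0 t x (q :: [seq val q | q <- qs])) =
      fun A => koopman_mode v0 t q * e q x / C * summability.partial_sum
        (fun qs : m.-tuple {q : nat | (0 < q)%N} =>
          \prod_(q <- [seq val q | q <- qs]) koopman_weight v0 t q) A.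
    apply/funext => A; rewrite /summability.partial_sum big_distrr/=.
    by apply: eq_bigr => qs _; rewrite koopman_termE.
  have FF := @summability.totally_filter (m.-tuple {q : nat | (0 < q)%N}).
  apply: cvgM; first exact: cvg_cst.
  exact: cvg_tuple_sum cS cT.
(* The geometric series contributes [1 / (1 - S)], and conservation of mass identifies
   [1 / (C * (1 - S))] with the coefficient 0 of [v t]. *)
- move=> q; have := @cvg_geometric_series R (koopman_mode v0 t q * e q x / C) S S1.
  rewrite (_ : _ * (1 - S)^-1 = coef e q (v t) * e q x)//.
  by rewrite modeE -invS invfM; ring.
- have [Hvt _ _] := Pvt; have := eigen_expansion_pointwise cV V_gt0 mu_e Hvt Ix.
  by apply: eq_fcvg => N; rewrite /series/= big_mkord.
Qed.

Lemma P1_f0 : P1 (f0_ e).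
Proof.
have C0 := int01_eigen0_gt0.
have f0E : f0_ e = fun x => C^-1 * e 0 x by apply/funext => x; rewrite /f0_ mulrC.
have [de /(_ 0%N)[de0 dde _ _]] := eigen_derivatives mu_e.
have cde := deriv_on_continuous01 dde.
split; last by rewrite f0E int01Z ?mulVf ?gt_eqF//; exact: continuous01_integrable.
- rewrite f0E; split; first exact: continuous01Z.
    by apply: L2_continuous01; exact: continuous01Z.
  exists (fun x => C^-1 * de 0%N x); apply: deriv_on_weak_derivative.
    exact: deriv_onZ.
  exact: continuous01Z.
- by move=> x Ix; rewrite divr_gt0//; exact: eigen_pos mu_e x Ix.
Qed.

(** With [d] the L2 distance from [g] to [f0_ e], the numerator of the ratio is at most [d * D] and
    the denominator at least [1 - d * C]; the ratio is below 1 as soon as [d * (D + C) < 1], whence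
    the radius. *)
Lemma nbhs_Omega : nbhs_in_P1 (f0_ e) (Omega_ e).
Proof.
have C0 := int01_eigen0_gt0; have Pf0 := P1_f0.
split => //; first by move=> f [].
set D := L2norm (fun x => 1 - coef e 0 (cst 1) * e 0 x).
have D0 : 0 <= D := L2norm_ge0 _.
have DC : 0 < D + C by rewrite ltr_wpDl.
exists (D + C)^-1; first by rewrite invr_gt0.
move=> g Pg gf0; split => //.
have g2 := P1_L2 Pg; have f02 := P1_L2 Pf0; have e2 := L2_eigen mu_e 0.
pose h x := g x + (-1) * f0_ e x.
have h2 : L2 h by apply: L2D => //; exact: L2Z.
pose d := L2norm h.
have d0 : 0 <= d := L2norm_ge0 h.
have dDC : d * (D + C) < 1.
  rewrite -ltr_pdivlMr// mul1r; apply: le_lt_trans gf0.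
  apply: le_trans (ler_L2norm_H1norm _); rewrite le_eqVlt; apply/orP; left; apply/eqP.
  by apply: eq_L2norm => x _ /=; rewrite /h mulN1r.
have cf0 : coef e 0 (f0_ e) = C^-1.
  have -> : coef e 0 (f0_ e) = C^-1 * coef e 0 (e 0).
    rewrite /coef -int01Z; last exact: L2_integrableM.
    by apply: eq_int01 => x _; rewrite /f0_; ring.
  by rewrite (coef_eigen mu_e) eqxx mulr1.
have ch : coef e 0 h = coef e 0 g - C^-1.
  by rewrite /h (eigen_coefD mu_e)// cf0 mulN1r.
(* As [f0_ e] is a multiple of [e 0], [g] and [h] have the same part orthogonal to [e 0]. *)
have nle : L2norm (fun x => g x - coef e 0 g * e 0 x) <= d.
  rewrite -(@ler_pXn2r _ 2%N) ?nnegrE ?L2norm_ge0//.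
  have -> : L2norm (fun x => g x - coef e 0 g * e 0 x) = L2norm (eigen_rem e h 1).
    apply: eq_L2norm => x _; rewrite /eigen_rem big_ord_recl big_ord0 addr0 /= ch /h /f0_.
    by field; rewrite gt_eqF.
  by rewrite (bessel mu_e)// lerBlDr lerDl sumr_ge0// => i _; exact: sqr_ge0.
have cg := coef0_gt0 mu_e Pg.
have cge : 1 - d * C <= coef e 0 g * C.
  have := ler_coef mu_e 0 h2; rewrite ch ler_norml => /andP[+ _].
  move=> /(ler_wpM2r (ltW C0)); rewrite mulrBl mulVf ?gt_eqF// mulNr -/d; lra.
rewrite /koopman_ratio ltr_pdivrMr ?mulr_gt0// mul1r; apply: lt_le_trans cge.
apply: (@le_lt_trans _ _ (d * D)); first by rewrite ler_wpM2r.
lra.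
Qed.

End Koopman.

Theorem mainTheorem6 (R : realType) (V : R -> R)
    (V_smooth : smooth01 V) (V_gt0 : forall x, unitI x -> 0 < V x)
    (mu : nat -> R) (e : nat -> R -> R) (mu_e : neumann_eigenbasis mu e V)
    (Phi : R -> (R -> R) -> R -> R) (Phi_flow : nonlinear_heat_flow V Phi) :
  (forall v0, P1 v0 ->
     forall t : R, 0 <= t -> (tau_ mu e v0 < t%:E)%E ->
     forall x, unitI x -> koopman_decomposition mu e v0 t x (Phi t v0 x))
  /\ nbhs_in_P1 (f0_ e) (Omega_ e)
  /\ (forall v0, Omega_ e v0 ->
      forall t : R, 0 <= t ->
      forall x, unitI x -> koopman_decomposition mu e v0 t x (Phi t v0 x)).
Proof.
have cV : continuous01 V.
  by have [df [<- ddf]] := V_smooth; exact: deriv_on_continuous01 (ddf 0%N).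
split=> [v0 Pv0 t t0 tau x Ix|].
  apply: (koopman_decompositionP cV V_gt0 mu_e Pv0 (Phi_flow v0 Pv0) t0 Ix).
  exact: (koopman_decay_lt1 mu_e).
split=> [|v0 [Pv0 r1] t t0 x Ix]; first exact: nbhs_Omega mu_e.
apply: (koopman_decompositionP cV V_gt0 mu_e Pv0 (Phi_flow v0 Pv0) t0 Ix).
(* For t >= 0 the decay factor is at most 1, so the bound on the ratio gives the strict inequality
   directly, without passing through [tau_]. *)
apply: le_lt_trans r1; rewrite ler_piMl ?(koopman_ratio_ge0 mu_e)//.
by rewrite -expR0 ler_expR mulNr oppr_le0 mulr_ge0// subr_ge0 ltW// (eigen_gap mu_e).
Qed.
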